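(* Let $d\ge2$, $M=d^2-1$, and let $\{\Lambda_j\}_{j=1}^M$ be the generalized Gell-Mann basis of $\mathfrak{su}(d)$. Let $h^*_{\max}>0$ be a scalar with $$h^*_{\max}\le\frac{\varepsilon_0^2}{16\,d\,\pi^2M^3K},$$ and set $H_j^*=h^*_{\max}\Lambda_j$ for $1\le j\le M$. Suppose that $\{\mathcal G_j\}_{j=1}^M\subset\mathrm{SU}(d)$ are approximations of $\{\mathcal G_j^*\}_{j=1}^M=\{\exp(iH_j^* )\}_{j=1}^M$. If $$\delta=\max_j\|\mathcal G_j^*-\mathcal G_j\|\le\frac{h^*_{\max}}{2\pi d^{5/2}}$$ (a quantity of order $O(d^{-19/2})$), then, with $H_j=\log\mathcal G_j$, $$h_{\max}=\max_j\|H_j\|\le h^*_{\max}\left(1+\frac1{2d^{5/2}}\right)\le\frac{\varepsilon_0^2}{8\pi^2dM^3K},$$ and the dimensionless minimum gain $\mu_N=\mu/h_{\max}$ of $\{H_j\}_{j=1}^M$ satisfies $\mu_N\ge\frac1{2\sqrt d}$. In particular, $\{\mathcal G_j\}_{j=1}^M$ is a good exponential basis for $\mathrm{SU}(d)$.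
   Context: $\|\cdot\|$ is the operator norm. $\mathfrak{su}(d)$ is the real vector space (dimension $d^2-1$) of traceless Hermitian $d\times d$ matrices, with $[X,Y]=i(XY-YX)$. For $U\in\mathrm{SU}(d)$, $\log U$ denotes an $H\in\mathfrak{su}(d)$ with $\exp(iH)=U$ and $\|H\|\le2\pi$, obtained as follows: diagonalize $U$ with eigenvalues $e^{i\tilde\theta_j}$, $\tilde\theta_j\in(-\pi,\pi]$, so $\sum_j\tilde\theta_j=2\pi k$ with $k\in\mathbb Z$, then subtract $2\pi$ from $k$ of the positive $\tilde\theta_j$ if $k>0$ (add $2\pi$ to $|k|$ of the negative ones if $k<0$), keeping the eigenvectors; in particular it is the principal logarithm when that is traceless. The generalized Gell-Mann basis consists of $\frac1{\sqrt2}(|\ell\rangle\langle k|+|k\rangle\langle\ell|)$ and $\frac i{\sqrt2}(|\ell\rangle\langle k|-|k\rangle\langle\ell|)$ for $1\le k<\ell\le d$, and $\sqrt{\frac1{\ell(\ell+1)}}\left(\sum_{k=1}^\ell|k\rangle\langle k|-\ell|\ell+1\rangle\langle\ell+1|\right)$ for $1\le\ell\le d-1$. Universal constants. $0<\delta_0<\pi$ and $C\ge1$ are universal constants (independent of $d$ and of the number of factors $r$) such that whenever $X_1,\dots,X_r\in\mathfrak{su}(d)$ with $\sum_j\|X_j\|\le\delta\le\delta_0$, $\log\prod_je^{iX_j}=\sum_jX_j+\frac12\sum_{i<j}[X_i,X_j]+R$ with $\|R\|\le C\delta^3$ (Baker--Campbell--Hausdorff), and moreover, when $r=2$ and $e^{iX_1}e^{iX_2}=e^{i(H+E)}e^{-iH}$,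 $\|R\|\le C(\|H\|+\|E\|)^2\|E\|$. Put $c=8\sqrt{2\pi}+8\pi+13+(32\pi)^{3/2}C$; $\varepsilon_0$ is a fixed constant with $0<\varepsilon_0<\min\{1/c^2,\delta_0^2/(32\pi)\}$, and $K$ is a fixed sufficiently large universal constant ($K\ge32\sqrt C$ suffices). For $H_1,\dots,H_M\in\mathfrak{su}(d)$: $h_{\max}=\max_j\|H_j\|$, the minimum gain is $\mu=\inf_{0\ne\alpha\in\mathbb R^M}\|\sum_j\alpha_jH_j\|/\|\alpha\|_\infty$, and $\mu_N=\mu/h_{\max}$. The unitaries $\mathcal G_j=\exp(iH_j)$ (with their inverses, always assumed available) form an exponential basis of $\mathrm{SU}(d)$ if $\{H_j\}_{j=1}^M$ is a basis of $\mathfrak{su}(d)$; the exponential basis is good if $$h_{\max}\le\frac{\varepsilon_0^2\mu_N^2}{\pi^2M^3K+\varepsilon_0\mu_N^2M}.$$ *)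

(* Defs.v *)
From mathcomp Require Import all_boot all_order all_algebra.
From mathcomp Require Import all_classical all_reals all_analysis.
From mathcomp Require Import complex.

Set Implicit Arguments.
Unset Strict Implicit.
Unset Printing Implicit Defensive.

Import Order.TTheory GRing.Theory Num.Theory numFieldNormedType.Exports.

Local Open Scope classical_set_scope.
Local Open Scope complex_scope.
Local Open Scope ring_scope.
Local Open Scope sesquilinear_scope.

Section Matrices.
Context {R : realType}.
Local Notation C := R[i].

Definition l2norm d (x : 'cV[C]_d) : R :=
  Num.sqrt (\sum_(k < d) Normc.normc (x k 0) ^+ 2).

Definition opnorm d (A : 'M[C]_d) : R :=
  sup [set l2norm (A *m x) | x in [set x : 'cV[C]_d | l2norm x <= 1]].

(* The sum of the exponential series; the limit of the partial sums is taken
   entrywise, on real and imaginary parts, as R[i] carries no canonical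
   topology. *)
Definition expmx d (A : 'M[C]_d) : 'M[C]_d :=
  let S n := \sum_(0 <= m < n) (m`!%:R : C)^-1 *: A ^+ m in
  \matrix_(i < d, j < d)
    (limn (fun n => complex.Re (S n i j)) +i* limn (fun n => complex.Im (S n i j))).

Definition su d : set 'M[C]_d := [set X | X \is hermsymmx /\ \tr X = 0].

Definition SU d : set 'M[C]_d := [set U | U \is unitarymx /\ \det U = 1].

(* The bracket of the real Lie algebra su(d) of Hermitian matrices; it carries
   a factor 'i, unlike the matrix commutator. *)
Definition bracket d (X Y : 'M[C]_d) : 'M[C]_d :=
  'i%C *: (X *m Y - Y *m X).

Definition expi (t : R) : C := cos t +i* sin t.

(* [is_log U H]: H is obtained from U by the log procedure. The eigenbasis V
   and the set S of the |k| eigenangles to be shifted by 2 pi are not canonical,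
   so log is a relation. When k = 0, S is empty and H is the principal
   logarithm. *)
Definition is_log d (U H : 'M[C]_d) : Prop :=
  exists (V : 'M[C]_d) (t : 'I_d -> R) (k : int) (S : {set 'I_d}),
  [/\ [/\ V \is unitarymx,
          forall j, - pi < t j <= pi &
          U = V *m diag_mx (\row_j expi (t j)) *m V ^t*],
      \sum_j t j = 2 * pi * k%:~R,
      #|S| = absz k /\
      (forall j, j \in S -> if 0 < k then 0 < t j else t j < 0) &
      H = V *m diag_mx (\row_j
            (t j - (if j \in S then if 0 < k then 2 * pi else - (2 * pi)
                    else 0))%:C) *m V ^t*].

(* In the second clause the two factors are the exponentials of X_1 = H + E and
   X_2 = - H: a bound for arbitrary X_1, X_2 whose product happens to equal
   e^{i(H+E)} e^{-iH} would be false (take H = 0 and X_1 close to - X_2). *)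
Definition bch_constants (delta0 B : R) : Prop :=
  (forall d r : nat, (1 < d)%N ->
   forall (X : 'I_r -> 'M[C]_d) (delta : R),
     (forall j, su (X j)) ->
     \sum_j opnorm (X j) <= delta -> delta <= delta0 ->
   forall L, is_log (\prod_(j < r) expmx ('i%C *: X j)) L ->
     opnorm (L - (\sum_j X j +
       2^-1 *: \sum_(i < r) \sum_(j < r | (i < j)%N) bracket (X i) (X j)))
     <= B * delta ^+ 3) /\
  (forall d : nat, (1 < d)%N ->
   forall H E : 'M[C]_d, su H -> su E ->
     opnorm (H + E) + opnorm (- H) <= delta0 ->
   forall L, is_log (expmx ('i%C *: (H + E)) *m expmx ('i%C *: - H)) L ->
     opnorm (L - ((H + E) - H + 2^-1 *: bracket (H + E) (- H)))
     <= B * (opnorm H + opnorm E) ^+ 2 * opnorm E).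

Definition c_const (B : R) : R :=
  8 * Num.sqrt (2 * pi) + 8 * pi + 13 + (32 * pi) `^ (3 / 2) * B.

(* Basis vectors are numbered from 0: the ket |l+1> of the 1-based convention
   is the basis vector of index l. *)
Definition gm_sym d (k l : 'I_d) : 'M[C]_d :=
  ((Num.sqrt 2)^-1)%:C *: (delta_mx l k + delta_mx k l).

Definition gm_asym d (k l : 'I_d) : 'M[C]_d :=
  ('i%C * ((Num.sqrt 2)^-1)%:C) *: (delta_mx l k - delta_mx k l).

Definition gm_diag d (l : 'I_d) : 'M[C]_d :=
  (Num.sqrt (1 / (l%:R * (l%:R + 1))))%:C *:
    (\sum_(k < d | (k < l)%N) delta_mx k k - l%:R *: delta_mx l l).

Definition gell_mann_seq d : seq 'M[C]_d :=
  [seq gm_sym p.1 p.2 | p : 'I_d * 'I_d <- enum {: 'I_d * 'I_d} & (p.1 < p.2)%N] ++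
  [seq gm_asym p.1 p.2 | p : 'I_d * 'I_d <- enum {: 'I_d * 'I_d} & (p.1 < p.2)%N] ++
  [seq gm_diag l | l : 'I_d <- enum 'I_d & (0 < l)%N].

Definition gell_mann d (j : 'I_(d ^ 2 - 1)) : 'M[C]_d :=
  nth 0 (gell_mann_seq d) j.

Definition max_norm M d (A : 'I_M -> 'M[C]_d) : R :=
  \big[Num.max/0]_(j < M) opnorm (A j).

Definition lin_comb M d (H : 'I_M -> 'M[C]_d) (a : 'rV[R]_M) : 'M[C]_d :=
  \sum_(j < M) (a 0 j)%:C *: H j.

Definition min_gain M d (H : 'I_M -> 'M[C]_d) : R :=
  inf [set opnorm (lin_comb H a) / \big[Num.max/0]_(j < M) `|a 0 j|
      | a in [set a : 'rV[R]_M | a != 0]].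

Definition norm_min_gain M d (H : 'I_M -> 'M[C]_d) : R :=
  min_gain H / max_norm H.

Definition su_basis M d (H : 'I_M -> 'M[C]_d) : Prop :=
  [/\ forall j, su (H j),
      forall a : 'rV[R]_M, lin_comb H a = 0 -> a = 0 &
      forall X, su X -> exists a : 'rV[R]_M, X = lin_comb H a].

Definition exp_basis M d (G H : 'I_M -> 'M[C]_d) : Prop :=
  (forall j, G j = expmx ('i%C *: H j)) /\ su_basis H.

Definition good_exp_basis (eps0 K : R) M d (G H : 'I_M -> 'M[C]_d) : Prop :=
  exp_basis G H /\
  max_norm H <= eps0 ^+ 2 * norm_min_gain H ^+ 2 /
    (pi ^+ 2 * M%:R ^+ 3 * K + eps0 * norm_min_gain H ^+ 2 * M%:R).

End Matrices.

(* Main.v *)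
Require Import Defs.
From mathcomp Require Import all_boot all_order all_algebra.
From mathcomp Require Import all_classical all_reals all_analysis.
From mathcomp Require Import complex.
From mathcomp Require Import ring lra.

(** Each Gell-Mann matrix has Frobenius norm 1 and they are orthonormal for the
    trace form, so comparing the operator norm with the Frobenius norm gives
    minimum gain at least [h / sqrt d] for the exact generators [h Lambda_j].

    The logarithm is Lipschitz near the identity with a dimension-free constant.
    Write [A], [B] for Hermitian matrices with spectra in [[-rho, rho]],
    [D = A - B] and [E = exp(iA) - exp(iB)].  In eigenbases of [A] and [B] the
    entries of [E] and [i D] are [(e^(i t_j) - e^(i s_k)) w_jk] and
    [i (t_j - s_k) w_jk], so [E - i D] has Frobenius norm at most
    [2 rho |D|_F].  The dimension factor [sqrt d] lost in passing from the
    Frobenius to the operator norm is absorbed by [rho], and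
    [opnorm D <= 2 opnorm E].  Since the eigenangles of the [G_j] are tiny, they
    sum to 0 and the logarithm is the principal one.  Summing the [M] errors costs
    half of the gain of the exact generators.

    A family of [d^2 - 1] independent elements of su(d) spans it because, with the
    identity, it is a free family in the real space of Hermitian matrices, of
    dimension [d^2]. *)

Set Implicit Arguments.
Unset Strict Implicit.
Unset Printing Implicit Defensive.

Import Order.TTheory GRing.Theory Num.Theory numFieldNormedType.Exports.
Import ComplexField.Normc.
Local Open Scope classical_set_scope.
Local Open Scope complex_scope.
Local Open Scope ring_scope.
Local Open Scope sesquilinear_scope.

(** * Cauchy-Schwarz and Minkowski inequalities for finite real sums *)

Section Euclidean.
Context {R : rcfType} {I : finType}.
Implicit Types f g : I -> R.

Lemma sum_sqr_ge0 f : 0 <= \sum_i f i ^+ 2.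
Proof. by apply: sumr_ge0 => i _; exact: sqr_ge0. Qed.

(** Lagrange's identity: the double sum of the squares [(f i * g j - f j * g i) ^+ 2] is twice the
    difference of the two sides. *)
Lemma Cauchy_Schwarz_sum f g :
  (\sum_i f i * g i) ^+ 2 <= (\sum_i f i ^+ 2) * (\sum_i g i ^+ 2).
Proof.
have : 0 <= \sum_i \sum_j (f i * g j - f j * g i) ^+ 2.
  by apply: sumr_ge0 => i _; exact: sum_sqr_ge0.
have -> : \sum_i \sum_j (f i * g j - f j * g i) ^+ 2 =
    ((\sum_i f i ^+ 2) * (\sum_i g i ^+ 2) - (\sum_i f i * g i) ^+ 2) *+ 2.
  transitivity (\sum_i \sum_j (f i ^+ 2 * g j ^+ 2)
      - (\sum_i \sum_j ((f i * g i) * (f j * g j))) *+ 2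
      + \sum_i \sum_j (f j ^+ 2 * g i ^+ 2)).
    rewrite -sumrMnl -sumrB -big_split /=; apply: eq_bigr => i _.
    rewrite -sumrMnl -sumrB -big_split /=; apply: eq_bigr => j _.
    by ring.
  rewrite [X in _ + X]exchange_big /= -!big_distrlr /=; ring.
by rewrite pmulrn_lge0 // subr_ge0.
Qed.

(** After squaring, only the cross term differs, and Cauchy-Schwarz bounds it. *)
Lemma sqrt_sum_sqrD f g :
  Num.sqrt (\sum_i (f i + g i) ^+ 2) <=
  Num.sqrt (\sum_i f i ^+ 2) + Num.sqrt (\sum_i g i ^+ 2).
Proof.
have F0 := sum_sqr_ge0 f; have G0 := sum_sqr_ge0 g.
rewrite -(ler_pXn2r (ltn0Sn 1)) ?nnegrE ?addr_ge0 ?sqrtr_ge0 //.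
rewrite sqrrD !sqr_sqrtr ?sum_sqr_ge0 // -sqrtrM //.
have -> : \sum_i (f i + g i) ^+ 2 = 
    \sum_i f i ^+ 2 + (\sum_i f i * g i) *+ 2 + \sum_i g i ^+ 2.
  by rewrite -sumrMnl -!big_split /=; apply: eq_bigr => i _; rewrite sqrrD.
rewrite lerD2r lerD2l lerMn2r /=; apply: le_trans (ler_norm _) _.
by rewrite -sqrtr_sqr ler_wsqrtr // Cauchy_Schwarz_sum.
Qed.

End Euclidean.

(** * The Frobenius norm and its comparison with the operator norm *)

Section Frobenius.
Context {R : realType}.
Local Notation C := R[i].

Lemma normc_ge0 (x : C) : 0 <= normc x.
Proof. by case: x => a b; exact: sqrtr_ge0. Qed.

Lemma normcD_le (x y : C) : normc (x + y) <= normc x + normc y.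
Proof. exact: (@le_normcD R). Qed.

Lemma normc_rC (a : R) : normc a%:C = `|a|.
Proof. by rewrite /= expr0n addr0 sqrtr_sqr. Qed.

Lemma sqr_normcC (x : C) : (normc x ^+ 2)%:C = Num.conj x * x.
Proof. by rewrite rmorphXn mulrC; exact: sqr_normc. Qed.

Lemma normc_conj (x : C) : normc (Num.conj x) = normc x.
Proof. by apply: complexI; exact: normcJ. Qed.

(** Rectangular shapes are allowed so that on column vectors this is the Euclidean norm. *)
Definition frob {m n} (A : 'M[C]_(m, n)) : R :=
  Num.sqrt (\sum_i \sum_j normc (A i j) ^+ 2).

Lemma frob_pair m n (A : 'M[C]_(m, n)) :
  frob A = Num.sqrt (\sum_(p : 'I_m * 'I_n) normc (A p.1 p.2) ^+ 2).
Proof. by rewrite /frob pair_bigA. Qed.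

Lemma frob_ge0 m n (A : 'M[C]_(m, n)) : 0 <= frob A.
Proof. exact: sqrtr_ge0. Qed.

Lemma sqr_frob m n (A : 'M[C]_(m, n)) :
  frob A ^+ 2 = \sum_i \sum_j normc (A i j) ^+ 2.
Proof. by rewrite sqr_sqrtr // sumr_ge0 // => i _; exact: sum_sqr_ge0. Qed.

(** In this form, invariance under unitary factors follows from the cyclicity of the trace. *)
Lemma sqr_frob_trace m n (A : 'M[C]_(m, n)) :
  (frob A ^+ 2)%:C = \tr (A *m A^t*).
Proof.
rewrite sqr_frob /mxtrace rmorph_sum /=; apply: eq_bigr => i _.
rewrite mxE rmorph_sum /=; apply: eq_bigr => j _.
by rewrite !mxE sqr_normcC mulrC.
Qed.

Lemma frob_trmxC m n (A : 'M[C]_(m, n)) : frob (A^t*) = frob A.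
Proof.
rewrite /frob exchange_big /=; congr Num.sqrt.
by do 2!apply: eq_bigr => ? _; rewrite !mxE normc_conj.
Qed.

Lemma frob_unitaryl n (V A : 'M[C]_n) : V \is unitarymx -> frob (V *m A) = frob A.
Proof.
move=> /unitarymxP VV.
apply/eqP; rewrite -(eqrXn2 (ltn0Sn 1)) ?frob_ge0 //; apply/eqP/complexI.
rewrite !sqr_frob_trace trmx_mul map_mxM !mulmxA mxtrace_mulC !mulmxA.
by rewrite (mulmx1C VV) mul1mx.
Qed.

Lemma frob_unitaryr n (V A : 'M[C]_n) : V \is unitarymx -> frob (A *m V) = frob A.
Proof.
move=> Vu; rewrite -[LHS]frob_trmxC trmx_mul map_mxM.
by rewrite (frob_unitaryl _ (etrans (trmxC_unitary V) Vu)) frob_trmxC.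
Qed.

Lemma frobD m n (A B : 'M[C]_(m, n)) : frob (A + B) <= frob A + frob B.
Proof.
rewrite !frob_pair; apply: le_trans (sqrt_sum_sqrD _ _).
rewrite ler_wsqrtr // ler_sum // => p _.
by rewrite mxE ler_pXn2r ?nnegrE ?addr_ge0 ?normc_ge0 ?normcD_le.
Qed.

Lemma frobZ m n (a : C) (A : 'M[C]_(m, n)) : frob (a *: A) = normc a * frob A.
Proof.
apply/eqP; rewrite -(eqrXn2 (ltn0Sn 1)) ?frob_ge0 ?mulr_ge0 ?normc_ge0 ?frob_ge0 //.
apply/eqP; rewrite exprMn !sqr_frob mulr_sumr; apply: eq_bigr => i _.
by rewrite mulr_sumr; apply: eq_bigr => j _; rewrite mxE normcM exprMn.
Qed.

Lemma frobN m n (A : 'M[C]_(m, n)) : frob (- A) = frob A.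
Proof. by rewrite -scaleN1r frobZ normcN normc1 mul1r. Qed.

Lemma frobB m n (A B : 'M[C]_(m, n)) : frob (A - B) <= frob A + frob B.
Proof. by apply: le_trans (frobD _ _) _; rewrite frobN. Qed.

Lemma normc_sum (I : finType) (F : I -> C) :
  normc (\sum_i F i) <= \sum_i normc (F i).
Proof.
elim/big_ind2: _ => [|x1 x2 y1 y2 h1 h2|//]; first by rewrite normc0.
exact: le_trans (normcD_le _ _) (lerD h1 h2).
Qed.

(** Cauchy-Schwarz applied to each entry of the product. *)
Lemma frobM m n p (A : 'M[C]_(m, n)) (B : 'M[C]_(n, p)) :
  frob (A *m B) <= frob A * frob B.
Proof.
rewrite -(ler_pXn2r (ltn0Sn 1)) ?nnegrE ?mulr_ge0 ?frob_ge0 //.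
rewrite exprMn !sqr_frob [X in _ * X]exchange_big /= big_distrlr /=.
apply: ler_sum => i _; apply: ler_sum => j _.
apply: le_trans (Cauchy_Schwarz_sum _ _); rewrite mxE.
rewrite ler_pXn2r ?nnegrE ?normc_ge0 ?sumr_ge0 // => [|k _]; last first.
  by rewrite mulr_ge0 ?normc_ge0.
by apply: le_trans (normc_sum _) _; apply: ler_sum => k _; rewrite normcM.
Qed.

Lemma l2normE d (x : 'cV[C]_d) : l2norm x = frob x.
Proof. by rewrite /l2norm /frob; under [in RHS]eq_bigr do rewrite big_ord1. Qed.

Lemma frob0 m n : frob (0 : 'M[C]_(m, n)) = 0.
Proof. by rewrite -(scale0r 0) frobZ normc0 mul0r. Qed.

(** The supremum defining [opnorm] is meaningful only for a nonempty bounded set; [frob A] is an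
    upper bound. *)
Lemma has_sup_opnorm d (A : 'M[C]_d) :
  has_sup [set l2norm (A *m x) | x in [set x : 'cV[C]_d | l2norm x <= 1]].
Proof.
split; first by exists (l2norm (A *m 0)); exists 0 => //=; rewrite l2normE frob0 ler01.
exists (frob A) => _ [x /= x1 <-]; move: x1; rewrite !l2normE => x1.
by apply: le_trans (frobM _ _) _; rewrite ler_piMr ?frob_ge0.
Qed.

Lemma opnorm_ubound d (A : 'M[C]_d) (x : 'cV[C]_d) :
  frob x <= 1 -> frob (A *m x) <= opnorm A.
Proof.
move=> x1; apply: (sup_upper_bound (has_sup_opnorm A)).
by exists x; rewrite /= l2normE.
Qed.

Lemma opnorm_le d (A : 'M[C]_d) b :
  (forall x : 'cV[C]_d, frob x <= 1 -> frob (A *m x) <= b) -> opnorm A <= b.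
Proof.
move=> Ab; apply: ge_sup; first by case: (has_sup_opnorm A).
by move=> _ [x /= x1 <-]; move: x1; rewrite !l2normE; exact: Ab.
Qed.

Lemma opnorm_ge0 d (A : 'M[C]_d) : 0 <= opnorm A.
Proof. by apply: le_trans (@opnorm_ubound d A 0 _); rewrite ?frob_ge0 ?frob0. Qed.

Lemma opnorm_frob d (A : 'M[C]_d) : opnorm A <= frob A.
Proof.
apply: opnorm_le => x x1.
by apply: le_trans (frobM _ _) _; rewrite ler_piMr ?frob_ge0.
Qed.

Lemma opnormD d (A B : 'M[C]_d) : opnorm (A + B) <= opnorm A + opnorm B.
Proof.
apply: opnorm_le => x x1; rewrite mulmxDl; apply: le_trans (frobD _ _) _.
by apply: lerD; exact: opnorm_ubound.
Qed.

Lemma opnormZ d a (A : 'M[C]_d) : opnorm (a *: A) <= normc a * opnorm A.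
Proof.
apply: opnorm_le => x x1; rewrite -scalemxAl frobZ.
by apply: ler_wpM2l; rewrite ?normc_ge0 //; exact: opnorm_ubound.
Qed.

Lemma opnormN d (A : 'M[C]_d) : opnorm (- A) = opnorm A.
Proof.
have N B : opnorm (- B : 'M[C]_d) <= opnorm B.
  rewrite -scaleN1r; apply: le_trans (opnormZ _ _) _.
  by rewrite (_ : normc (-1) = 1) ?mul1r //= !oppr0 sqrrN expr0n expr1n addr0 sqrtr1.
by apply/le_anti/andP; split; [exact: N|rewrite -[A in leLHS]opprK; exact: N].
Qed.

Lemma opnorm_sum d (I : finType) (F : I -> 'M[C]_d) :
  opnorm (\sum_i F i) <= \sum_i opnorm (F i).
Proof.
elim/big_ind2: _ => [|x1 x2 y1 y2 h1 h2|//].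
  by apply: le_trans (opnorm_frob _) _; rewrite frob0.
exact: le_trans (opnormD _ _) (lerD h1 h2).
Qed.

Lemma frob_col d (A : 'M[C]_d) : frob A ^+ 2 = \sum_j frob (col j A) ^+ 2.
Proof.
rewrite sqr_frob exchange_big /=; apply: eq_bigr => j _; rewrite sqr_frob.
by apply: eq_bigr => i _; rewrite big_ord1 mxE.
Qed.

(** Each of the [d] columns is the image of a unit basis vector, so its norm is at most
    [opnorm A]. *)
Lemma frob_opnorm d (A : 'M[C]_d) : frob A <= Num.sqrt d%:R * opnorm A.
Proof.
rewrite -(ler_pXn2r (ltn0Sn 1)) ?nnegrE ?mulr_ge0 ?frob_ge0 ?sqrtr_ge0 ?opnorm_ge0 //.
rewrite exprMn (sqr_sqrtr (ler0n _ d)) frob_col mulr_natl.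
rewrite -[d in _ *+ d]card_ord -sumr_const; apply: ler_sum => j _.
rewrite ler_pXn2r ?nnegrE ?frob_ge0 ?opnorm_ge0 // colE; apply: opnorm_ubound.
rewrite -(ler_pXn2r (ltn0Sn 1)) ?nnegrE ?frob_ge0 ?ler01 // sqr_frob expr1n.
under eq_bigr do rewrite big_ord1 mxE andbT.
rewrite (bigD1 j) //= eqxx big1 ?addr0 => [|i /negPf->]; last first.
  by rewrite normc0 expr0n.
by rewrite normc1 expr1n.
Qed.

End Frobenius.

(** * The matrix exponential of a unitarily diagonalized Hermitian matrix *)

Section Exponential.
Context {R : realType}.
Local Notation C := R[i].

(** Since i^m = (-1)^(m/2) i^(m mod 2), with m/2 rounded down, even terms are real cosine terms and
    odd terms are imaginary sine terms. *)
Lemma exp_coeffE (x : R) (m : nat) :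
  (m`!%:R : C)^-1 * ('i%C * x%:C) ^+ m = cos_coeff x m +i* sin_coeff x m.
Proof.
have -> : (m`!%:R : C)^-1 = (m`!%:R^-1)%:C by rewrite fmorphV /= rmorph_nat.
rewrite exprMn -rmorphXn mulrCA -rmorphM /cos_coeff /sin_coeff.
have -> : 'i%C ^+ m = (-1) ^+ m./2 * 'i%C ^+ odd m :> C.
  by rewrite -[in LHS](odd_double_half m) exprD mulrC -muln2 mulnC exprM sqr_i.
have -> : (-1) ^+ m./2 = ((-1) ^+ m./2)%:C :> C by rewrite rmorphXn rmorphN1.
(* [sin_coeff] carries the exponent [m.-1./2], which agrees with [m./2] for odd [m]. *)
have half_pred : odd m -> m.-1./2 = m./2.
  by case: m => //= m /negbTE om; rewrite uphalf_half om.
rewrite /= -[exprz (-1) m./2]/((-1) ^+ m./2).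
case: (odd m) half_pred => [->|_] //=.
  by rewrite expr1 mul1r; simpc; congr (_ *i); ring.
rewrite expr0 mul1r !mul0r mulr1; simpc; congr (_ +i* _); ring.
Qed.

Lemma complex_sum (I : Type) (r : seq I) (F G : I -> R) :
  \sum_(i <- r) (F i +i* G i) = (\sum_(i <- r) F i) +i* (\sum_(i <- r) G i).
Proof.
elim: r => [|a r IH]; first by rewrite !big_nil.
by rewrite !big_cons IH; simpc.
Qed.

Lemma Re_sum (I : Type) (r : seq I) (F : I -> C) :
  complex.Re (\sum_(i <- r) F i) = \sum_(i <- r) complex.Re (F i).
Proof.
rewrite (eq_bigr (fun i => complex.Re (F i) +i* complex.Im (F i))) => [|i _].
  by rewrite complex_sum.
by case: (F i).
Qed.

Lemma Im_sum (I : Type) (r : seq I) (F : I -> C) :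
  complex.Im (\sum_(i <- r) F i) = \sum_(i <- r) complex.Im (F i).
Proof.
rewrite (eq_bigr (fun i => complex.Re (F i) +i* complex.Im (F i))) => [|i _].
  by rewrite complex_sum.
by case: (F i).
Qed.

Lemma conj_diagX d (V : 'M[C]_d) (z : 'I_d -> C) m : V \is unitarymx ->
  (V *m diag_mx (\row_j z j) *m V^t*) ^+ m =
  V *m diag_mx (\row_j z j ^+ m) *m V^t*.
Proof.
move=> Vu; elim: m => [|m IH].
  rewrite expr0 (_ : diag_mx _ = 1%:M) ?mulmx1; first exact/esym/unitarymxP.
  by apply/matrixP => i j; rewrite !mxE expr0.
rewrite exprS IH -mulmxE !mulmxA -[V *m _ *m V^t* *m V]mulmxA.
rewrite (mulmx1C (unitarymxP Vu)) mulmx1; congr (_ *m _).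
rewrite -!mulmxA mulmx_diag; congr (_ *m diag_mx _).
by apply/rowP => j; rewrite !mxE exprS.
Qed.

Lemma conj_diagE d (V : 'M[C]_d) (z : 'I_d -> C) i j :
  (V *m diag_mx (\row_k z k) *m V^t*) i j =
  \sum_k (V i k * Num.conj (V j k)) * z k.
Proof.
by rewrite mul_mx_diag mxE; apply: eq_bigr => k _; rewrite !mxE mulrAC.
Qed.

Lemma cvg_finsum (I : Type) (r : seq I) (f : I -> nat -> R) (l : I -> R) :
  (forall i, f i @ \oo --> l i) ->
  (fun n => \sum_(i <- r) f i n) @ \oo --> \sum_(i <- r) l i.
Proof.
move=> fl; elim: r => [|i r IH].
  by under eq_fun do rewrite big_nil; rewrite big_nil; exact: cvg_cst.
by under eq_fun do rewrite big_cons; rewrite big_cons; exact: cvgD.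
Qed.

(** A fixed complex weight acts real-linearly on the pair of real and imaginary parts, so real
    convergence passes to both components. This matches the componentwise limits in [expmx]. *)
Lemma cvg_complex_comb (I : finType) (w : I -> C) (c s : I -> nat -> R) (a b : I -> R) :
  (forall k, c k @ \oo --> a k) -> (forall k, s k @ \oo --> b k) ->
  (fun n => complex.Re (\sum_k w k * (c k n +i* s k n))) @ \oo
     --> complex.Re (\sum_k w k * (a k +i* b k)) /\
  (fun n => complex.Im (\sum_k w k * (c k n +i* s k n))) @ \oo
     --> complex.Im (\sum_k w k * (a k +i* b k)).
Proof.
move=> ca sb.
have reE x y k : complex.Re (w k * (x +i* y)) =
    complex.Re (w k) * x - complex.Im (w k) * y by case: (w k).
have imE x y k : complex.Im (w k * (x +i* y)) =
    complex.Re (w k) * y + complex.Im (w k) * x by case: (w k).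
split.
- under eq_fun do rewrite Re_sum; rewrite Re_sum.
  apply: cvg_finsum => k; under eq_fun do rewrite reE; rewrite reE.
  by apply: cvgB; apply: cvgMl_tmp.
- under eq_fun do rewrite Im_sum; rewrite Im_sum.
  apply: cvg_finsum => k; under eq_fun do rewrite imE; rewrite imE.
  by apply: cvgD; apply: cvgMl_tmp.
Qed.

Lemma cvg_series_cos (x : R) : series (cos_coeff x) @ \oo --> cos x.
Proof. by rewrite unlock; exact: is_cvg_series_cos_coeff. Qed.

Lemma cvg_series_sin (x : R) : series (sin_coeff x) @ \oo --> sin x.
Proof. by rewrite unlock; exact: is_cvg_series_sin_coeff. Qed.

(** Powers act on the eigenvalues alone, so every entry of a partial sum is a fixed combination of
    partial sums of the cosine and sine series at the [t k]. *)
Lemma expmx_conj_diag d (V : 'M[C]_d) (t : 'I_d -> R) : V \is unitarymx ->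
  expmx ('i%C *: (V *m diag_mx (\row_j (t j)%:C) *m V^t*)) =
  V *m diag_mx (\row_j expi (t j)) *m V^t*.
Proof.
move=> Vu; apply/matrixP => i j; rewrite conj_diagE mxE.
set A := 'i%C *: _.
have SE n : (\sum_(0 <= m < n) (m`!%:R : C)^-1 *: A ^+ m) i j =
    \sum_k (V i k * Num.conj (V j k)) *
      (series (cos_coeff (t k)) n +i* series (sin_coeff (t k)) n).
  rewrite summxE /series /=; under [RHS]eq_bigr do rewrite -complex_sum mulr_sumr.
  rewrite exchange_big /=; apply: eq_bigr => m _.
  have -> : A = V *m diag_mx (\row_j ('i%C * (t j)%:C)) *m V^t*.
    rewrite /A scalemxAl scalemxAr; congr (_ *m _ *m _).
    by rewrite -linearZ /=; congr diag_mx; apply/rowP => k; rewrite !mxE.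
  rewrite conj_diagX // mxE conj_diagE mulr_sumr; apply: eq_bigr => k _.
  by rewrite -exp_coeffE mulrCA.
have [cR cI] := @cvg_complex_comb _ (fun k => V i k * Num.conj (V j k))
  (fun k => series (cos_coeff (t k))) (fun k => series (sin_coeff (t k)))
  (fun k => cos (t k)) (fun k => sin (t k))
  (fun k => @cvg_series_cos (t k)) (fun k => @cvg_series_sin (t k)).
have -> : (fun n => complex.Re ((\sum_(0 <= m < n) (m`!%:R : C)^-1 *: A ^+ m) i j))
    = fun n => complex.Re (\sum_k (V i k * Num.conj (V j k)) *
      (series (cos_coeff (t k)) n +i* series (sin_coeff (t k)) n)).
  by apply/funext => n; rewrite SE.
have -> : (fun n => complex.Im ((\sum_(0 <= m < n) (m`!%:R : C)^-1 *: A ^+ m) i j))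
    = fun n => complex.Im (\sum_k (V i k * Num.conj (V j k)) *
      (series (cos_coeff (t k)) n +i* series (sin_coeff (t k)) n)).
  by apply/funext => n; rewrite SE.
by rewrite (cvg_lim _ cR) // (cvg_lim _ cI) //; case: (\sum_k _).
Qed.

End Exponential.

(** * Estimates for e^(it) near t = 0 *)

Section Trigonometry.
Context {R : realType}.

Lemma mvt_dist_le (f df : R -> R) (rho K a b : R) :
  (forall x : R, is_derive x 1 f (df x)) ->
  (forall x, `|x| <= rho -> `|df x| <= K) ->
  `|a| <= rho -> `|b| <= rho -> `|f a - f b| <= K * `|a - b|.
Proof.
move=> fd dfK; wlog ab : a b / b <= a => [hw|].
  by case: (leP b a) => [|/ltW] ?; [|rewrite distrC (distrC a)] => *; exact: hw.
move=> /ler_normlP[_ aR] /ler_normlP[bR _].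
have fcont : {within `[b, a], continuous f}.
  by apply: derivable_within_continuous => x _; exact: (@ex_derive _ _ _ _ _ _ _ (fd x)).
have [c] := MVT_segment ab (fun x _ => fd x) fcont.
rewrite in_itv /= => /andP[bc ca] ->; rewrite normrM ler_wpM2r //.
by apply: dfK; rewrite ler_norml lerNl (le_trans _ bR) ?lerN2 // (le_trans ca).
Qed.

Lemma cos_sub1_le (x : R) : `|cos x - 1| <= `|x|.
Proof.
rewrite -cos0 -[leRHS]mul1r -{2}[x]subr0.
apply: (@mvt_dist_le cos (fun x => - sin x) `|x|); rewrite ?normr0 //.
by move=> y _; rewrite normrN sin_max.
Qed.

Lemma sin_le_norm (x : R) : `|sin x| <= `|x|.
Proof.
rewrite -[sin x]subr0 -sin0 -[leRHS]mul1r -{2}[x]subr0.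
by apply: (@mvt_dist_le sin cos `|x|); rewrite ?normr0 // => y _; exact: cos_max.
Qed.

Lemma cos_dist_le (rho x y : R) : `|x| <= rho -> `|y| <= rho ->
  `|cos x - cos y| <= rho * `|x - y|.
Proof.
apply: (@mvt_dist_le cos (fun x => - sin x)) => z zr.
by rewrite normrN (le_trans (sin_le_norm z)).
Qed.

Lemma sin_sub_id_le (rho x y : R) : `|x| <= rho -> `|y| <= rho ->
  `|(sin x - sin y) - (x - y)| <= rho * `|x - y|.
Proof.
move=> xr yr; have -> : (sin x - sin y) - (x - y) = (sin x - x) - (sin y - y) by ring.
apply: (@mvt_dist_le (fun x => sin x - x) (fun x => cos x - 1)) xr yr => z zr.
by rewrite (le_trans (cos_sub1_le z)).
Qed.

Lemma normc_le_add (a b : R) : normc (a +i* b) <= `|a| + `|b|.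
Proof.
rewrite -(ler_pXn2r (ltn0Sn 1)) ?nnegrE ?normc_ge0 ?addr_ge0 //=.
rewrite sqr_sqrtr ?addr_ge0 ?sqr_ge0 // sqrrD !real_normK ?num_real //.
by rewrite lerD2r lerDl mulrn_wge0 // mulr_ge0.
Qed.

(** The real part is cos x - cos y, the imaginary part the increment of sin z - z. On [-rho, rho]
    both functions have derivative at most rho in absolute value, whence the factor 2 rho. *)
Lemma expi_sub_linear (rho x y : R) : `|x| <= rho -> `|y| <= rho ->
  normc (expi x - expi y - 'i%C * (x%:C - y%:C)) <= 2 * rho * `|x - y|.
Proof.
move=> xr yr; rewrite /expi; simpc.
apply: le_trans (normc_le_add _ _) _.
rewrite -[y - x]opprB -mulrA mulr_natl mulr2n.
by apply: lerD; [exact: cos_dist_le|exact: sin_sub_id_le].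
Qed.

Lemma expi_sub1_le (x : R) : normc (expi x - 1) <= 2 * `|x|.
Proof.
rewrite /expi; have -> : cos x +i* sin x - 1 = (cos x - 1) +i* sin x :> R[i].
  by simpc.
apply: le_trans (normc_le_add _ _) _.
by rewrite mulr_natl mulr2n lerD ?cos_sub1_le ?sin_le_norm.
Qed.

Lemma sqr_expi_sub1 (x : R) : normc (expi x - 1) ^+ 2 = 2 - 2 * cos x.
Proof.
have -> : expi x - 1 = (cos x - 1) +i* sin x :> R[i] by rewrite /expi; simpc.
rewrite /= sqr_sqrtr ?addr_ge0 ?sqr_ge0 // sin2cos2; ring.
Qed.

(** If |t| > 2e, monotonicity of cos on [0, pi] gives |e^(it) - 1|^2 = 2 - 2 cos t > 2 - 2 cos(2e) =
    4 sin(e)^2 >= e^2, a contradiction. The bound e <= 1/2 keeps 2e in [0, pi] and gives sin e >= e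
    - e^2 >= e/2. *)
Lemma angle_le (t e : R) : - pi <= t <= pi -> e <= 1 / 2 ->
  normc (expi t - 1) <= e -> `|t| <= 2 * e.
Proof.
move=> tpi e2 te; have e0 : 0 <= e := le_trans (normc_ge0 _) te.
rewrite leNgt; apply/negP => ut.
have : cos `|t| < cos (2 * e).
  rewrite ltr_cos // in_itv /=; first by rewrite mulr_ge0 //=; have := pi_ge2 R; lra.
  by rewrite normr_ge0 ler_norml.
have : normc (expi t - 1) ^+ 2 <= e ^+ 2 by rewrite ler_pXn2r ?nnegrE ?normc_ge0.
rewrite sqr_expi_sub1 cos_norm (mulr_natl e) cos_mulr2n cos2sin2.
have : `|(sin e - sin 0) - (e - 0)| <= e * `|e - 0|.
  by apply: sin_sub_id_le; rewrite ?normr0 ?ger0_norm.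
rewrite sin0 !subr0 (ger0_norm e0) ler_norml => /andP[sl _].
have ee : e * e <= e * (1 / 2) by rewrite ler_wpM2l.
have se : e / 2 <= sin e by lra.
have : (e / 2) ^+ 2 <= sin e ^+ 2 by rewrite ler_pXn2r ?nnegrE //; lra.
rewrite expr_div_n; lra.
Qed.

End Trigonometry.

(** * Lipschitz bound for the logarithm and stability of [is_log] *)

Section Logarithm.
Context {R : realType}.
Local Notation C := R[i].

(** Reading rows in the first eigenbasis and columns in the second turns the difference into an
    entrywise product with the overlap matrix [V^t* *m W], although the two matrices need not
    commute. *)
Lemma conj_diag_subE d (V W : 'M[C]_d) (x y : 'I_d -> C) :
  V \is unitarymx -> W \is unitarymx ->
  V^t* *m (V *m diag_mx (\row_j x j) *m V^t* - W *m diag_mx (\row_j y j) *m W^t*) *m W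
  = \matrix_(j, k) ((x j - y k) * (V^t* *m W) j k).
Proof.
move=> Vu Wu; rewrite mulmxBr mulmxBl !mulmxA.
rewrite (mulmx1C (unitarymxP Vu)) mul1mx -[_ *m W^t* *m W]mulmxA.
rewrite (mulmx1C (unitarymxP Wu)) mulmx1 -[_ *m V^t* *m W]mulmxA.
rewrite -?mulmxA [X in _ - X]mulmxA; move: (V^t* *m W) => w; apply/matrixP => j k.
by rewrite mul_diag_mx mul_mx_diag !mxE mulrBl [w j k * _]mulrC.
Qed.

Lemma frob_le_entry m n (c : R) (A B : 'M[C]_(m, n)) : 0 <= c ->
  (forall i j, normc (A i j) <= c * normc (B i j)) -> frob A <= c * frob B.
Proof.
move=> c0 AB; rewrite -(ler_pXn2r (ltn0Sn 1)) ?nnegrE ?mulr_ge0 ?frob_ge0 //.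
rewrite exprMn !sqr_frob mulr_sumr; apply: ler_sum => i _.
rewrite mulr_sumr; apply: ler_sum => j _; rewrite -exprMn.
by rewrite ler_pXn2r ?nnegrE ?mulr_ge0 ?normc_ge0.
Qed.

Lemma frob_unitary_comparison d (V W D E M N : 'M[C]_d) (a : C) (c : R) :
  V \is unitarymx -> W \is unitarymx -> 0 <= c ->
  V^t* *m E *m W = M -> V^t* *m D *m W = N ->
  (forall j k, normc (M j k - a * N j k) <= c * normc (N j k)) ->
  frob (E - a *: D) <= c * frob D.
Proof.
move=> Vu Wu c0 EM DN cmp.
have frobVW X : frob X = frob (V^t* *m X *m W).
  by rewrite (frob_unitaryr _ Wu) (frob_unitaryl _ (etrans (trmxC_unitary V) Vu)).
rewrite [in leLHS]frobVW [in leRHS]frobVW mulmxBr mulmxBl -scalemxAr -scalemxAl EM DN.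
apply: frob_le_entry => [//|j k]; move: (cmp j k).
by rewrite !mxE.
Qed.

(** Both differences carry the same overlap factor in each entry, so a scalar bound on pairs of
    eigenvalues becomes a Frobenius bound. *)
Lemma frob_conj_diag_comparison d (V W : 'M[C]_d) (x y u v : 'I_d -> C) (a : C) (c : R) :
  V \is unitarymx -> W \is unitarymx -> 0 <= c ->
  (forall j k, normc (x j - y k - a * (u j - v k)) <= c * normc (u j - v k)) ->
  frob (V *m diag_mx (\row_j x j) *m V^t* - W *m diag_mx (\row_j y j) *m W^t*
        - a *: (V *m diag_mx (\row_j u j) *m V^t* - W *m diag_mx (\row_j v j) *m W^t*)) <=
  c * frob (V *m diag_mx (\row_j u j) *m V^t* - W *m diag_mx (\row_j v j) *m W^t*).
Proof.
move=> Vu Wu c0 cmp.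
apply: (frob_unitary_comparison Vu Wu c0 (conj_diag_subE x y Vu Wu)
  (conj_diag_subE u v Vu Wu)) => j k.
rewrite !mxE mulrA -mulrBl !normcM mulrA.
by apply: ler_wpM2r; [exact: normc_ge0|exact: cmp].
Qed.

Lemma normc_i : normc ('i%C : C) = 1.
Proof. by rewrite /= expr0n expr1n add0r sqrtr1. Qed.

(** From 4 rho <= 1 the error is at most half of |D|_F, so |D|_F <= 2 |E|_F <= 2 sqrt(d) ||E||.
    Hence ||D|| <= ||E|| + 2 rho |D|_F <= (1 + 4 rho sqrt(d)) ||E|| <= 2 ||E||. *)
Lemma opnorm_le_of_frob_close d (D E : 'M[C]_d) (rho : R) :
  0 <= rho -> 4 * rho <= 1 -> 4 * rho * Num.sqrt d%:R <= 1 ->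
  frob (E - 'i%C *: D) <= 2 * rho * frob D -> opnorm D <= 2 * opnorm E.
Proof.
move=> rho0 small4 small err.
have iD : D = - 'i%C *: ('i%C *: D) by rewrite scalerA mulNr -expr2 sqr_i opprK scale1r.
have normNi : normc (- 'i%C : C) = 1 by rewrite normcN normc_i.
have Dfrob : frob D <= frob E + 2 * rho * frob D.
  rewrite [in leLHS]iD frobZ normNi mul1r.
  have -> : 'i%C *: D = E - (E - 'i%C *: D) by rewrite opprB addrC subrK.
  by apply: le_trans (frobB _ _) _; rewrite lerD2l.
have Dop : opnorm D <= opnorm E + 2 * rho * frob D.
  rewrite [in leLHS]iD; apply: le_trans (opnormZ _ _) _; rewrite normNi mul1r.
  have -> : 'i%C *: D = E - (E - 'i%C *: D) by rewrite opprB addrC subrK.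
  apply: le_trans (opnormD _ _) _; rewrite lerD2l opnormN.
  exact: le_trans (opnorm_frob _) err.
have Efrob := frob_opnorm E.
have fD0 := frob_ge0 D; have oE0 := opnorm_ge0 E.
have h1 : 4 * rho * frob D <= 1 * frob D by rewrite ler_wpM2r.
have h2 : 4 * rho * frob E <= 4 * rho * (Num.sqrt d%:R * opnorm E).
  by rewrite ler_wpM2l ?mulr_ge0 // frob_opnorm.
have h3 : 4 * rho * Num.sqrt d%:R * opnorm E <= 1 * opnorm E by rewrite ler_wpM2r.
clear iD normNi err; move: (frob D) (frob E) (opnorm D) (opnorm E) Dfrob Dop fD0 oE0 h1 h2 h3.
move=> fD fE oD oE Dfrob Dop fD0 oE0 h1 h2 h3.
have h4 : rho * fD <= rho * (2 * fE) by rewrite ler_wpM2l //; lra.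
lra.
Qed.

Lemma log_lipschitz d (V W : 'M[C]_d) (t s : 'I_d -> R) (rho : R) :
  V \is unitarymx -> W \is unitarymx ->
  (forall j, `|t j| <= rho) -> (forall j, `|s j| <= rho) -> 0 <= rho ->
  4 * rho <= 1 -> 4 * rho * Num.sqrt d%:R <= 1 ->
  opnorm (V *m diag_mx (\row_j (t j)%:C) *m V^t*
          - W *m diag_mx (\row_j (s j)%:C) *m W^t*) <=
  2 * opnorm (V *m diag_mx (\row_j expi (t j)) *m V^t*
           - W *m diag_mx (\row_j expi (s j)) *m W^t*).
Proof.
move=> Vu Wu tr sr rho0 small4 small; apply: (opnorm_le_of_frob_close rho0 small4 small).
apply: (@frob_conj_diag_comparison d V W (fun j => expi (t j)) (fun j => expi (s j))
  (fun j => (t j)%:C) (fun j => (s j)%:C) 'i%C (2 * rho) Vu Wu) => [|j k].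
  by rewrite mulr_ge0.
apply: le_trans (expi_sub_linear (tr j) (sr k)) _.
by rewrite -rmorphB normc_rC.
Qed.

(** The spectral theorem for normal matrices, with the adjoint of [spectralmx] as eigenbasis; taking
    real parts changes nothing because the spectrum is real. *)
Lemma hermitian_diagonalization d (A : 'M[C]_d) : A \is hermsymmx ->
  exists (W : 'M[C]_d) (s : 'I_d -> R), W \is unitarymx /\
    A = W *m diag_mx (\row_j (s j)%:C) *m W^t*.
Proof.
move=> Ah; exists ((spectralmx A)^t*), (fun j => complex.Re (spectral_diag A 0 j)).
split; first by rewrite trmxC_unitary spectral_unitarymx.
have /orthomx_spectralP {1}-> := hermitian_normalmx Ah.
rewrite invmx_unitary ?spectral_unitarymx // trmxCK; congr (_ *m diag_mx _ *m _).
apply/rowP => j; rewrite mxE RRe_real //.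
by have /mxOverP/(_ 0 j) := hermitian_spectral_diag_real Ah.
Qed.

Lemma conj_real_diag_herm d (V : 'M[C]_d) (t : 'I_d -> R) :
  V *m diag_mx (\row_j (t j)%:C) *m V^t* \is hermsymmx.
Proof.
apply/is_hermitianmxP; rewrite expr0 scale1r !trmx_mul !map_mxM trmxCK mulmxA.
rewrite tr_diag_mx map_diag_mx; congr (_ *m diag_mx _ *m _).
by apply/rowP => j; rewrite !mxE; exact/esym/conjc_real.
Qed.

Lemma frob_conj_diag d (V : 'M[C]_d) (z : 'I_d -> C) : V \is unitarymx ->
  frob (V *m diag_mx (\row_j z j) *m V^t*) ^+ 2 = \sum_j normc (z j) ^+ 2.
Proof.
move=> Vu; rewrite frob_unitaryr ?trmxC_unitary // frob_unitaryl // sqr_frob.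
apply: eq_bigr => j _; rewrite (bigD1 j) //= !mxE eqxx mulr1n big1 ?addr0 // => k kj.
by rewrite !mxE eq_sym (negPf kj) mulr0n normc0 expr0n.
Qed.

Lemma frob_conj_diag_le d (V : 'M[C]_d) (x y : 'I_d -> C) (c : R) :
  V \is unitarymx -> 0 <= c -> (forall j, normc (x j) <= c * normc (y j)) ->
  frob (V *m diag_mx (\row_j x j) *m V^t*) <= c * frob (V *m diag_mx (\row_j y j) *m V^t*).
Proof.
move=> Vu c0 xy; rewrite -(ler_pXn2r (ltn0Sn 1)) ?nnegrE ?mulr_ge0 ?frob_ge0 //.
rewrite [leLHS](frob_conj_diag x Vu) exprMn [X in _ <= _ * X](frob_conj_diag y Vu) mulr_sumr.
apply: ler_sum => j _.
by rewrite -exprMn ler_pXn2r ?nnegrE ?mulr_ge0 ?normc_ge0.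
Qed.

Lemma mxtrace_conj_diag d (V : 'M[C]_d) (z : 'I_d -> C) : V \is unitarymx ->
  \tr (V *m diag_mx (\row_j z j) *m V^t*) = \sum_j z j.
Proof.
move=> Vu; rewrite mxtrace_mulC mulmxA (mulmx1C (unitarymxP Vu)) mul1mx mxtrace_diag.
by apply: eq_bigr => j _; rewrite mxE.
Qed.

Lemma conj_diag_sub1 d (V : 'M[C]_d) (z : 'I_d -> C) : V \is unitarymx ->
  V *m diag_mx (\row_j z j) *m V^t* - 1%:M = V *m diag_mx (\row_j (z j - 1)) *m V^t*.
Proof.
move=> Vu; rewrite -{1}(unitarymxP Vu) -mulmxBl -{2}[V]mulmx1 -mulmxBr.
congr (_ *m _ *m _); apply/matrixP => i j; rewrite !mxE.
by case: eqP; rewrite ?mulr1n // !mulr0n subr0.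
Qed.

(** [U] is within 3h of the identity in Frobenius norm, so its eigenangles are at most 6h in
    absolute value. Their sum is then too small to be a nonzero multiple of 2 pi, no angle is
    shifted, and the Lipschitz bound applies with rho = 6h. *)
Lemma is_log_perturbation d (U H A : 'M[C]_d) (h delta : R) :
  (0 < d)%N -> is_log U H -> A \is hermsymmx -> frob A <= h -> 24 * d%:R * h <= 1 ->
  opnorm (expmx ('i%C *: A) - U) <= delta -> Num.sqrt d%:R * delta <= h ->
  [/\ su H, expmx ('i%C *: H) = U & opnorm (H - A) <= 2 * delta].
Proof.
move=> d0 [V [t [k [S [[Vu tpi UE] tk [Sk _] HE]]]]] Aherm Ah small dist dh.
have h0 : 0 <= h := le_trans (frob_ge0 _) Ah.
have [W [s [Wu AE]]] := hermitian_diagonalization Aherm.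
have sh j : `|s j| <= h.
  apply: le_trans Ah; rewrite -normc_rC.
  rewrite -(ler_pXn2r (ltn0Sn 1)) ?nnegrE ?normc_ge0 ?frob_ge0 // AE frob_conj_diag //.
  by rewrite (bigD1 j) //= lerDl sumr_ge0 // => *; exact: sqr_ge0.
have expA : expmx ('i%C *: A) = W *m diag_mx (\row_j expi (s j)) *m W^t*.
  by rewrite AE expmx_conj_diag.
have expA1 : frob (expmx ('i%C *: A) - 1%:M) <= 2 * h.
  rewrite expA (conj_diag_sub1 _ Wu); apply: le_trans (_ : 2 * frob A <= _); last first.
    by rewrite ler_wpM2l.
  rewrite AE; apply: (frob_conj_diag_le (x := fun j => expi (s j) - 1)
    (y := fun j => (s j)%:C) Wu) => // j.
  by rewrite normc_rC; exact: expi_sub1_le.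
have U1 : frob (U - 1%:M) <= 3 * h.
  have -> : U - 1%:M = (expmx ('i%C *: A) - 1%:M) - (expmx ('i%C *: A) - U).
    by rewrite opprB [RHS]addrC addrA subrK.
  apply: le_trans (frobB _ _) _.
  have : frob (expmx ('i%C *: A) - U) <= h.
    apply: le_trans (frob_opnorm _) _; apply: le_trans dh.
    by rewrite ler_wpM2l ?sqrtr_ge0.
  lra.
have d1 : 1 <= d%:R :> R by rewrite ler1n.
have hd : h <= d%:R * h by rewrite ler_peMl.
(* The squared deviation of one eigenvalue from 1 is a term of the sum equal to the squared
   Frobenius norm of [U - 1%:M]; [angle_le] is used with e = 3h. *)
have th j : `|t j| <= 6 * h.
  have -> : 6 * h = 2 * (3 * h) by ring.
  apply: angle_le; [by have /andP[/ltW -> ->] := tpi j|lra|].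
  apply: le_trans U1.
  rewrite -(ler_pXn2r (ltn0Sn 1)) ?nnegrE ?normc_ge0 ?frob_ge0 //.
  rewrite UE conj_diag_sub1 // frob_conj_diag //.
  by rewrite (bigD1 j) //= lerDl sumr_ge0 // => *; exact: sqr_ge0.
(* The angles sum to at most 6dh <= 1/4 in absolute value, whereas a nonzero integer [k] would give
   at least 2 pi. *)
have k0 : k = 0.
  have : `|\sum_j t j| <= 1 / 4.
    apply: le_trans (ler_norm_sum _ _ _) _; apply: le_trans (_ : \sum_(j < d) 6 * h <= _).
      by apply: ler_sum => j _; exact: th.
    by rewrite sumr_const card_ord -mulr_natl; lra.
  apply: contraPP => /eqP kN0; rewrite tk normrM gtr0_norm ?mulr_gt0 ?pi_gt0 //.
  have k1 : 1 <= `|k%:~R| :> R by rewrite -intr_norm ler1z -gtz0_ge1 normr_gt0.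
  apply/negP; rewrite -ltNge; have := pi_ge2 R => pi2.
  by apply: lt_le_trans (_ : 2 * pi * 1 <= _); [lra|rewrite ler_wpM2l //; lra].
have S0 : S = finset.set0 by apply/eqP; rewrite -cards_eq0 Sk k0.
have {}HE : H = V *m diag_mx (\row_j (t j)%:C) *m V^t*.
  rewrite HE; congr (_ *m diag_mx _ *m _).
  by apply/rowP => j; rewrite !mxE S0 inE subr0.
have t0 : \sum_j t j = 0 by rewrite tk k0 mulr0.
split.
- split; first by rewrite HE conj_real_diag_herm.
  by rewrite HE mxtrace_conj_diag // -rmorph_sum /= t0.
- by rewrite HE expmx_conj_diag.
(* With rho = 6h, the condition 4 rho sqrt(d) <= 1 follows from 24 d h <= 1 because sqrt(d) <= d. *)
- have q1 : Num.sqrt d%:R <= d%:R :> R.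
    by rewrite -[leRHS]ger0_norm // -sqrtr_sqr ler_wsqrtr // expr2 ler_peMl.
  have s6 j : `|s j| <= 6 * h by apply: le_trans (sh j) _; lra.
  have h6 : 0 <= 6 * h by lra.
  have small4 : 4 * (6 * h) <= 1 by lra.
  have smalld : 4 * (6 * h) * Num.sqrt d%:R <= 1.
    apply: le_trans (_ : 4 * (6 * h) * d%:R <= _); last by lra.
    by rewrite ler_wpM2l //; lra.
  have := log_lipschitz Vu Wu th s6 h6 small4 smalld.
  rewrite -HE -AE -UE -expA -[opnorm (U - _)]opnormN opprB => lip; apply: (le_trans lip).
  rewrite (ler_pM2l (ltr0Sn _ 1)); exact: dist.
Qed.

End Logarithm.

(** * Orthonormality of the generalized Gell-Mann matrices *)

Section GellMann.
Context {R : realType}.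
Local Notation C := R[i].

(** The Hilbert-Schmidt inner product, linear in the first argument. *)
Definition frob_dot {d} (A B : 'M[C]_d) : C := \tr (A *m B^t*).

Lemma frob_dotE d (A B : 'M[C]_d) :
  frob_dot A B = \sum_i \sum_j A i j * Num.conj (B i j).
Proof.
apply: eq_bigr => i _; rewrite mxE; apply: eq_bigr => j _.
by rewrite !mxE.
Qed.

Lemma frob_dotC d (A B : 'M[C]_d) : frob_dot A B = Num.conj (frob_dot B A).
Proof.
rewrite !frob_dotE rmorph_sum; apply: eq_bigr => i _.
rewrite rmorph_sum; apply: eq_bigr => j _.
by rewrite rmorphM /= conjCK mulrC.
Qed.

Lemma frob_dotZl d a (A B : 'M[C]_d) : frob_dot (a *: A) B = a * frob_dot A B.
Proof. by rewrite /frob_dot -scalemxAl mxtraceZ. Qed.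

Lemma frob_dotDl d (A A' B : 'M[C]_d) : frob_dot (A + A') B = frob_dot A B + frob_dot A' B.
Proof. by rewrite /frob_dot mulmxDl mxtraceD. Qed.

Lemma frob_dotNl d (A B : 'M[C]_d) : frob_dot (- A) B = - frob_dot A B.
Proof. by rewrite /frob_dot mulNmx raddfN. Qed.

Lemma frob_dot_delta d (a b : 'I_d) (B : 'M[C]_d) :
  frob_dot (delta_mx a b) B = Num.conj (B a b).
Proof.
rewrite frob_dotE (bigD1 a) //= [X in _ + X]big1 ?addr0 => [|i ia]; last first.
  by apply: big1 => j _; rewrite mxE (negPf ia) mul0r.
rewrite (bigD1 b) //= big1 ?addr0 => [|j jb]; first by rewrite mxE !eqxx mul1r.
by rewrite mxE (negPf jb) andbF mul0r.
Qed.

Lemma frob_dot_suml d (I : finType) (F : I -> 'M[C]_d) B :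
  frob_dot (\sum_i F i) B = \sum_i frob_dot (F i) B.
Proof. by rewrite /frob_dot mulmx_suml raddf_sum. Qed.

(** Pythagoras for an orthonormal family with real coefficients. *)
Lemma sqr_frob_comb d n (L : 'I_n -> 'M[C]_d) (a : 'rV[R]_n) :
  (forall i j, frob_dot (L i) (L j) = (i == j)%:R) ->
  frob (lin_comb L a) ^+ 2 = \sum_j a 0 j ^+ 2.
Proof.
move=> orth; apply: complexI; rewrite sqr_frob_trace rmorph_sum /=.
transitivity (frob_dot (lin_comb L a) (lin_comb L a)) => //.
rewrite {1}/lin_comb frob_dot_suml; apply: eq_bigr => i _.
rewrite frob_dotZl frob_dotC frob_dot_suml (bigD1 i) //= big1 ?addr0 => [|j ji].
  rewrite frob_dotZl orth eqxx mulr1 expr2 rmorphM; congr (_ * _); exact: conjc_real.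
by rewrite frob_dotZl orth (negPf ji) mulr0.
Qed.

Let isq2 : R := (Num.sqrt 2)^-1.

Lemma isq2K : isq2%:C * isq2%:C = 2^-1 :> C.
Proof. by rewrite -rmorphM /= -invfM -expr2 sqr_sqrtr // fmorphV rmorph_nat. Qed.

Lemma gm_symE d (k l a b : 'I_d) : (gm_sym k l : 'M[C]_d) a b =
  isq2%:C * (((a == l) && (b == k))%:R + ((a == k) && (b == l))%:R).
Proof. by rewrite !mxE. Qed.

Lemma gm_asymE d (k l a b : 'I_d) : (gm_asym k l : 'M[C]_d) a b =
  'i%C * isq2%:C * (((a == l) && (b == k))%:R - ((a == k) && (b == l))%:R).
Proof. by rewrite !mxE. Qed.

Definition gm_coef d (l : 'I_d) : R := Num.sqrt (1 / (l%:R * (l%:R + 1))).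

Lemma gm_diagE d (l a b : 'I_d) : (gm_diag l : 'M[C]_d) a b =
  (gm_coef l * ((a < l)%N%:R - l%:R * (a == l)%:R) * (a == b)%:R)%:C.
Proof.
rewrite /gm_diag !mxE summxE.
rewrite (_ : \sum_(k < d | _) _ = ((a < l)%N && (a == b))%:R); last first.
  have [al|al] /= := boolP (a < l)%N.
    rewrite (bigD1 a) //= mxE eqxx eq_sym big1 ?addr0 // => k /andP[_ ka].
    by rewrite mxE eq_sym (negPf ka).
  by apply: big1 => k kl; rewrite mxE; case: eqP => //= ak; rewrite ak kl in al.
rewrite -mulrA rmorphM; congr (_ * _).
rewrite mulrBl -mulrA -!natrM !mulnb rmorphB rmorphM !rmorph_nat.
by rewrite natrM; case: (a =P l) => [->|] //=; rewrite eq_sym.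
Qed.

Lemma frob_dot_sym d (k l : 'I_d) (B : 'M[C]_d) : frob_dot (gm_sym k l) B =
  isq2%:C * (Num.conj (B l k) + Num.conj (B k l)).
Proof. by rewrite frob_dotZl frob_dotDl !frob_dot_delta. Qed.

Lemma frob_dot_asym d (k l : 'I_d) (B : 'M[C]_d) : frob_dot (gm_asym k l) B =
  'i%C * isq2%:C * (Num.conj (B l k) - Num.conj (B k l)).
Proof. by rewrite frob_dotZl frob_dotDl frob_dotNl !frob_dot_delta. Qed.

Lemma conj_rC (r : R) : Num.conj (r%:C : C) = r%:C.
Proof. exact: conjc_real. Qed.

Lemma conj_i : Num.conj ('i%C : C) = - 'i%C.
Proof. by rewrite -[LHS]/('i^*)%C; simpc. Qed.

(** An increasing pair is never the swap of another; this kills the cross indicators in the products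
    of off-diagonal matrices. *)
Lemma pair_lt_cross d (p q : 'I_d * 'I_d) : (p.1 < p.2)%N -> (q.1 < q.2)%N ->
  (p.2 == q.1) && (p.1 == q.2) = false.
Proof.
move=> pp qq; apply/negP => /andP[/eqP e1 /eqP e2].
by move: pp qq; rewrite e1 e2 => h1 h2; have := ltn_trans h1 h2; rewrite ltnn.
Qed.

Lemma pair_eqE d (p q : 'I_d * 'I_d) : (p.2 == q.2) && (p.1 == q.1) = (p == q).
Proof. by rewrite andbC. Qed.

Lemma frob_dot_sym_sym d (p q : 'I_d * 'I_d) : (p.1 < p.2)%N -> (q.1 < q.2)%N ->
  frob_dot (gm_sym p.1 p.2) (gm_sym q.1 q.2) = (p == q)%:R :> C.
Proof.
move=> pp qq; rewrite frob_dot_sym !gm_symE pair_eqE (pair_lt_cross pp qq).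
rewrite [(p.1 == _) && (p.2 == _)]andbC (pair_lt_cross pp qq) andbC pair_eqE.
rewrite addr0 add0r !rmorphM /= conj_rC rmorph_nat.
have -> : forall y z : C, y * (y * z + y * z) = (2 * (y * y)) * z by move=> y z; ring.
by rewrite isq2K mulfV ?mul1r // pnatr_eq0.
Qed.

Lemma frob_dot_asym_asym d (p q : 'I_d * 'I_d) : (p.1 < p.2)%N -> (q.1 < q.2)%N ->
  frob_dot (gm_asym p.1 p.2) (gm_asym q.1 q.2) = (p == q)%:R :> C.
Proof.
move=> pp qq; rewrite frob_dot_asym !gm_asymE pair_eqE (pair_lt_cross pp qq).
rewrite [(p.1 == _) && (p.2 == _)]andbC (pair_lt_cross pp qq) andbC pair_eqE.
rewrite !(subr0, sub0r) !rmorphM rmorphN /= conj_rC conj_i rmorph_nat.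
have -> : forall x y z : C, x * y * (- x * y * z - - x * y * - z) =
  - (x ^+ 2) * (2 * (y * y)) * z by move=> x y z; ring.
by rewrite sqr_i opprK isq2K mul1r mulfV ?mul1r // pnatr_eq0.
Qed.

Lemma frob_dot_sym_asym d (p q : 'I_d * 'I_d) : (p.1 < p.2)%N -> (q.1 < q.2)%N ->
  frob_dot (gm_sym p.1 p.2) (gm_asym q.1 q.2) = 0 :> C.
Proof.
move=> pp qq; rewrite frob_dot_sym !gm_asymE pair_eqE (pair_lt_cross pp qq).
rewrite [(p.1 == _) && (p.2 == _)]andbC (pair_lt_cross pp qq) andbC pair_eqE.
by rewrite !(subr0, sub0r) mulrN rmorphN addrN mulr0.
Qed.

Lemma gm_diag_offdiag d (l a b : 'I_d) : a != b -> (gm_diag l : 'M[C]_d) a b = 0.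
Proof. by rewrite gm_diagE => /negPf->; rewrite mulr0. Qed.

Lemma frob_dot_sym_diag d (p : 'I_d * 'I_d) (l : 'I_d) : (p.1 < p.2)%N ->
  frob_dot (gm_sym p.1 p.2) (gm_diag l) = 0 :> C.
Proof.
move=> pp; have pn : p.1 != p.2 by rewrite -val_eqE ltn_eqF.
by rewrite frob_dot_sym !gm_diag_offdiag // 1?eq_sym // conjC0 addr0 mulr0.
Qed.

Lemma frob_dot_asym_diag d (p : 'I_d * 'I_d) (l : 'I_d) : (p.1 < p.2)%N ->
  frob_dot (gm_asym p.1 p.2) (gm_diag l) = 0 :> C.
Proof.
move=> pp; have pn : p.1 != p.2 by rewrite -val_eqE ltn_eqF.
by rewrite frob_dot_asym !gm_diag_offdiag // 1?eq_sym // conjC0 subr0 mulr0.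
Qed.

Lemma frob_dot_diag_diag d (l m : 'I_d) : frob_dot (gm_diag l) (gm_diag m) =
  (\sum_(a < d) (gm_coef l * ((a < l)%N%:R - l%:R * (a == l)%:R)) *
    (gm_coef m * ((a < m)%N%:R - m%:R * (a == m)%:R)))%:C :> C.
Proof.
rewrite frob_dotE rmorph_sum; apply: eq_bigr => a _.
rewrite (bigD1 a) //= big1 ?addr0 => [|b ba]; last first.
  by rewrite [gm_diag l a b]gm_diag_offdiag ?mul0r // eq_sym.
by rewrite (gm_diagE l) (gm_diagE m) eqxx !mulr1 conj_rC -rmorphM.
Qed.

Lemma card_ltn_ord d (l : 'I_d) : (\sum_(a < d | a < l) 1)%N = l.
Proof. by rewrite -(big_ord_widen d (fun=> 1%N)) ?sum1_card ?card_ord // ltnW. Qed.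

Lemma sum_ltn_ord d (l : 'I_d) : \sum_(a < d) (a < l)%N%:R = l%:R :> R.
Proof. by rewrite -natr_sum -[in RHS](card_ltn_ord l) [in RHS]big_mkcond. Qed.

Lemma sqr_gm_coef d (l : 'I_d) : (0 < l)%N -> gm_coef l ^+ 2 * (l%:R + l%:R ^+ 2) = 1.
Proof.
move=> l0; have lp : 0 < l%:R :> R by rewrite ltr0n.
rewrite sqr_sqrtr ?divr_ge0 ?mulr_ge0 ?addr_ge0 //; field.
by rewrite !gt_eqF // addr_gt0.
Qed.

(** Up to [gm_coef l], the diagonal has [l] entries 1 and one entry -l, with squares summing to l +
    l^2. *)
Lemma frob_dot_diag_norm d (l : 'I_d) : (0 < l)%N ->
  frob_dot (gm_diag l) (gm_diag l) = 1 :> C.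
Proof.
move=> l0; rewrite frob_dot_diag_diag; transitivity ((1 : R)%:C) => //.
congr (_%:C); rewrite -[RHS](sqr_gm_coef l0).
transitivity (gm_coef l ^+ 2 * (\sum_(a < d) (a < l)%N%:R + l%:R ^+ 2)); last first.
  by rewrite sum_ltn_ord.
rewrite mulrDr mulr_sumr.
rewrite (eq_bigr (fun a : 'I_d => gm_coef l ^+ 2 * (a < l)%N%:R +
   gm_coef l ^+ 2 * l%:R ^+ 2 * (a == l)%:R)) => [|a _]; last first.
  case: (a =P l) => [->|_]; first by rewrite ltnn /=; ring.
  by case: (a < l)%N => /=; ring.
rewrite big_split /=; congr (_ + _).
by rewrite (bigD1 l) //= eqxx mulr1 big1 ?addr0 // => a /negPf->; rewrite mulr0.
Qed.

(** On the support of [gm_diag l] the diagonal of [gm_diag m] is constant, so the product is a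
    multiple of the trace of [gm_diag l], which vanishes. *)
Lemma frob_dot_diag_orth d (l m : 'I_d) : (l < m)%N ->
  frob_dot (gm_diag l) (gm_diag m) = 0 :> C.
Proof.
move=> lm; rewrite frob_dot_diag_diag (eq_bigr (fun a : 'I_d =>
  gm_coef l * gm_coef m * ((a < l)%N%:R - l%:R * (a == l)%:R))) => [|a _]; last first.
  have [al|la|/ord_inj al] := ltngtP a l.
  - have am := ltn_trans al lm; rewrite am -!val_eqE !ltn_eqF //=; ring.
  - by rewrite -val_eqE gtn_eqF //= mulr0 subr0 mulr0 mul0r mulr0.
  - by rewrite al lm eqxx -val_eqE ltn_eqF //=; ring.
rewrite -mulr_sumr sumrB sum_ltn_ord -mulr_sumr (bigD1 l) //= eqxx big1 ?addr0.
  by rewrite mulr1 subrr mulr0.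
by move=> a /negPf->.
Qed.

Lemma frob_dot_normS d (s : seq 'M[C]_d) : pairwise (fun A B => frob_dot A B == 0) s ->
  all (fun A => frob_dot A A == 1) s ->
  forall i j, (i < size s)%N -> (j < size s)%N ->
  frob_dot (nth 0 s i) (nth 0 s j) = (i == j)%:R.
Proof.
move=> /(pairwiseP 0) pw /(all_nthP 0) nm i j si sj.
have [ij|ji|<-] := ltngtP i j; last exact/eqP/nm.
  exact/eqP/pw.
by rewrite frob_dotC (eqP (pw j i sj si ji)) conjC0.
Qed.

Lemma pairwise_filter_map (T : eqType) d (P : pred T) (f : T -> 'M[C]_d) (e : rel T) (s : seq T) :
  pairwise e s ->
  (forall p q, P p -> P q -> e p q -> frob_dot (f p) (f q) = 0) ->
  pairwise (fun A B => frob_dot A B == 0) [seq f p | p <- s & P p].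
Proof.
move=> us fo; rewrite pairwise_map.
have : pairwise e [seq p <- s | P p] by exact: pairwise_filter.
apply: (sub_in_pairwise (P := P)); last exact: filter_all.
by move=> p q pP qP pq; rewrite /= fo.
Qed.

Lemma allrel_filter_map (T U : eqType) d (P : pred T) (Q : pred U)
    (f : T -> 'M[C]_d) (g : U -> 'M[C]_d) (s : seq T) (t : seq U) :
  (forall p q, P p -> Q q -> frob_dot (f p) (g q) = 0) ->
  allrel (fun A B => frob_dot A B == 0) [seq f p | p <- s & P p] [seq g q | q <- t & Q q].
Proof.
move=> fg; rewrite allrel_mapl allrel_mapr; apply/allrelP => p q.
by rewrite !mem_filter => /andP[pP _] /andP[qQ _]; rewrite fg.
Qed.

Lemma gell_mann_seq_orth d i j : (i < size (@gell_mann_seq R d))%N ->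
  (j < size (@gell_mann_seq R d))%N ->
  frob_dot (nth 0 (@gell_mann_seq R d) i) (nth 0 (@gell_mann_seq R d) j) = (i == j)%:R.
Proof.
have pw : pairwise (fun p q : 'I_d * 'I_d => p != q) (enum {: 'I_d * 'I_d}).
  by rewrite -uniq_pairwise enum_uniq.
apply: frob_dot_normS; rewrite /gell_mann_seq.
  rewrite !pairwise_cat allrel_catr; apply/and3P; split; last first.
  - apply/and3P; split.
    + by apply: allrel_filter_map => p l pp _; exact: frob_dot_asym_diag.
    + by apply: pairwise_filter_map pw _ => p q pp qq /negPf pq;
        rewrite frob_dot_asym_asym // pq.
    (* Orthogonality of diagonal matrices is available for l < m, so this block is ordered by the
       increasing enumeration and not merely by distinctness. *)
    + apply: (pairwise_filter_map (e := fun l m : 'I_d => (l < m)%N)) => [|l m _ _].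
        rewrite -(pairwise_map val ltn) val_enum_ord.
        by rewrite -(sorted_pairwise ltn_trans) iota_ltn_sorted.
      exact: frob_dot_diag_orth.
  - by apply: pairwise_filter_map pw _ => p q pp qq /negPf pq;
      rewrite frob_dot_sym_sym // pq.
  - apply/andP; split; apply: allrel_filter_map => p q pp qq.
      exact: frob_dot_sym_asym.
    exact: frob_dot_sym_diag.
rewrite !all_cat !all_map; apply/and3P; split; apply/allP => p;
  rewrite mem_filter => /andP[pp _] /=.
- by rewrite frob_dot_sym_sym // eqxx.
- by rewrite frob_dot_asym_asym // eqxx.
- by rewrite frob_dot_diag_norm.
Qed.

Lemma size_ltn_pairs d :
  size [seq p : 'I_d * 'I_d <- enum {: 'I_d * 'I_d} | (p.1 < p.2)%N] = 'C(d, 2).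
Proof.
rewrite size_filter -sum1_count big_enum_cond /=.
rewrite -(pair_big_dep predT (fun i j : 'I_d => (i < j)%N) (fun _ _ => 1%N)) /=.
rewrite (exchange_big_dep predT) //= -bin2_sum big_mkord.
by apply: eq_bigr => j _; exact: card_ltn_ord.
Qed.

Lemma size_pos_ord d : size [seq l : 'I_d <- enum 'I_d | (0 < l)%N] = d.-1.
Proof.
case: d => [|d]; first by rewrite size_filter -sum1_count big_enum_cond big_ord0.
rewrite size_filter -sum1_count big_enum_cond big_mkcond big_ord_recl /= add0n.
by rewrite sum1_card card_ord.
Qed.

(** The blocks contribute d(d - 1)/2 twice and d - 1 once. Consequently the default value of [nth]
    in [gell_mann] is never reached. *)
Lemma size_gell_mann_seq d : size (@gell_mann_seq R d) = (d ^ 2 - 1)%N.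
Proof.
rewrite !size_cat !size_map !size_ltn_pairs size_pos_ord addnA addnn.
case: d => [//|d]; rewrite bin2 /=.
have -> : ((d.+1 * d)./2.*2 = d.+1 * d)%N.
  by rewrite -[RHS]odd_double_half oddM /= andNb.
by rewrite -mulnn [in RHS]mulnS addSn subn1 /= addnC.
Qed.

Lemma gell_mann_orth d (i j : 'I_(d ^ 2 - 1)) :
  frob_dot (gell_mann i) (gell_mann j) = (i == j)%:R :> C.
Proof. by rewrite gell_mann_seq_orth ?size_gell_mann_seq. Qed.


Lemma gell_mann_frob d (i : 'I_(d ^ 2 - 1)) : frob (gell_mann i : 'M[C]_d) = 1.
Proof.
apply/eqP; rewrite -(eqrXn2 (ltn0Sn 1)) ?frob_ge0 // expr1n; apply/eqP/complexI.
by rewrite sqr_frob_trace; have := gell_mann_orth i i; rewrite eqxx.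
Qed.

Lemma gm_sym_herm d (k l : 'I_d) : (gm_sym k l : 'M[C]_d) \is hermsymmx.
Proof.
apply/is_hermitianmxP; rewrite expr0 scale1r; apply/matrixP => a b.
rewrite [RHS]mxE [X in Num.conj X]mxE !gm_symE rmorphM rmorphD /= conj_rC !rmorph_nat addrC.
by rewrite ![(b == _) && _]andbC.
Qed.

Lemma gm_asym_herm d (k l : 'I_d) : (gm_asym k l : 'M[C]_d) \is hermsymmx.
Proof.
apply/is_hermitianmxP; rewrite expr0 scale1r; apply/matrixP => a b.
rewrite [RHS]mxE [X in Num.conj X]mxE !gm_asymE !rmorphM rmorphB /= conj_rC conj_i !rmorph_nat.
by rewrite !mulNr -mulrN opprB ![(b == _) && _]andbC.
Qed.

Lemma gm_diag_herm d (l : 'I_d) : (gm_diag l : 'M[C]_d) \is hermsymmx.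
Proof.
apply/is_hermitianmxP; rewrite expr0 scale1r; apply/matrixP => a b.
rewrite [RHS]mxE [X in Num.conj X]mxE !gm_diagE conj_rC [b == a]eq_sym.
by case: (a =P b) => [->//|_]; rewrite !mulr0.
Qed.

Lemma gell_mann_herm d (j : 'I_(d ^ 2 - 1)) : (gell_mann j : 'M[C]_d) \is hermsymmx.
Proof.
have : (gell_mann j : 'M[C]_d) \in @gell_mann_seq R d.
  by rewrite mem_nth // size_gell_mann_seq.
rewrite !mem_cat => /or3P[] /mapP[p _ ->].
- exact: gm_sym_herm.
- exact: gm_asym_herm.
- exact: gm_diag_herm.
Qed.

End GellMann.

(** * Independent families of d^2 - 1 elements span su(d) *)

Section Spanning.
Context {R : realType}.
Local Notation C := R[i].

Definition ReImsum (z : C) : R := complex.Re z + complex.Im z.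

Lemma ReImsumD x y : ReImsum (x + y) = ReImsum x + ReImsum y.
Proof. by case: x y => [a b] [c d]; rewrite /ReImsum /=; ring. Qed.

Lemma ReImsumZ (r : R) x : ReImsum (r%:C * x) = r * ReImsum x.
Proof. by case: x => [a b]; rewrite /ReImsum /=; ring. Qed.

(* On Hermitian matrices, where the real part is symmetric and the imaginary
   part antisymmetric, taking Re + Im entrywise loses no information; it
   identifies them with the real matrices of the same size. *)
Definition herm_coord {d} (A : 'M[C]_d) : 'rV[R]_(d * d) :=
  mxvec (\matrix_(i, j) ReImsum (A i j)).

Lemma herm_coordD d (A B : 'M[C]_d) : herm_coord (A + B) = herm_coord A + herm_coord B.
Proof.
by rewrite /herm_coord -linearD; congr mxvec; apply/matrixP => i j; rewrite !mxE ReImsumD.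
Qed.

Lemma herm_coordZ d (r : R) (A : 'M[C]_d) : herm_coord (r%:C *: A) = r *: herm_coord A.
Proof.
by rewrite /herm_coord -linearZ; congr mxvec; apply/matrixP => i j; rewrite !mxE ReImsumZ.
Qed.

Lemma herm_coordN d (A : 'M[C]_d) : herm_coord (- A) = - herm_coord A.
Proof.
by rewrite -[in RHS]scaleN1r -herm_coordZ rmorphN1 scaleN1r.
Qed.

Lemma herm_coord_sum d (I : finType) (F : I -> 'M[C]_d) :
  herm_coord (\sum_i F i) = \sum_i herm_coord (F i).
Proof.
elim/big_ind2: _ => [|A x B y <- <-|//]; last by rewrite herm_coordD.
by rewrite -(scale0r 0) -[0 in LHS]/((0 : R)%:C) herm_coordZ scale0r.
Qed.

Lemma herm_entry d (A : 'M[C]_d) i j : A \is hermsymmx -> A i j = Num.conj (A j i).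
Proof.
move=> /is_hermitianmxP; rewrite expr0 scale1r => {1}->.
by rewrite !mxE.
Qed.

(** For an entry x + iy, positions (i, j) and (j, i) give x + y = 0 and x - y = 0. *)
Lemma herm_coord_inj d (A : 'M[C]_d) : A \is hermsymmx -> herm_coord A = 0 -> A = 0.
Proof.
move=> Ah A0.
have M0 i j : ReImsum (A i j) = 0.
  by have := congr1 (fun v => vec_mx v i j) A0; rewrite mxvecK raddf0 !mxE.
apply/matrixP => i j; rewrite mxE.
have := M0 i j; have := M0 j i; rewrite (herm_entry j i Ah); case: (A i j) => x y.
rewrite /ReImsum /= => e1 e2; apply/eqP; rewrite eq_complex /=.
by apply/andP; split; apply/eqP; lra.
Qed.

Lemma suB d (A B : 'M[C]_d) : su A -> su B -> su (A - B).
Proof.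
move=> [Ah At] [Bh Bt]; split; last by rewrite raddfB /= At Bt subrr.
apply/is_hermitianmxP; rewrite expr0 scale1r; apply/matrixP => i j.
by rewrite !mxE rmorphB /= -!herm_entry.
Qed.

Lemma su_lin_comb n d (H : 'I_n -> 'M[C]_d) (a : 'rV[R]_n) :
  (forall j, su (H j)) -> su (lin_comb H a).
Proof.
move=> sH; split.
  apply/is_hermitianmxP; rewrite expr0 scale1r; apply/matrixP => i j.
  rewrite [RHS]mxE [X in Num.conj X]mxE !summxE rmorph_sum; apply: eq_bigr => k _.
  by rewrite mxE [in RHS]mxE rmorphM /= -herm_entry ?(sH k).1 // conj_rC.
rewrite raddf_sum big1 //= => k _.
by rewrite mxtraceZ (sH k).2 mulr0.
Qed.

Lemma su_span_of_independent d (H : 'I_(d ^ 2 - 1) -> 'M[C]_d) (X : 'M[C]_d) :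
  (0 < d)%N -> (forall j, su (H j)) ->
  (forall a : 'rV[R]_(d ^ 2 - 1), lin_comb H a = 0 -> a = 0) ->
  su X -> exists a : 'rV[R]_(d ^ 2 - 1), X = lin_comb H a.
Proof.
move=> d0 sH indep sX.
pose B := col_mx (herm_coord (1%:M : 'M[C]_d)) (\matrix_(j < d ^ 2 - 1) herm_coord (H j)).
have BE (b : R) (a : 'rV[R]_(d ^ 2 - 1)) :
    row_mx b%:M a *m B = herm_coord (b%:C *: 1%:M + lin_comb H a).
  rewrite mul_row_col mul_scalar_mx herm_coordD herm_coordZ; congr (_ + _).
  rewrite herm_coord_sum mulmx_sum_row; apply: eq_bigr => j _.
  by rewrite herm_coordZ rowK.
have herm_comb (b : R) (Y : 'M[C]_d) : Y \is hermsymmx -> b%:C *: 1%:M + Y \is hermsymmx.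
  move=> Yh; apply/is_hermitianmxP; rewrite expr0 scale1r; apply/matrixP => i j.
  rewrite !mxE rmorphD rmorphM /= -herm_entry // conj_rC rmorph_nat.
  by rewrite [j == i]eq_sym.
(* The trace of the left side is b d, so the identity is independent of su(d). *)
have scalar0 (b : R) (Y : 'M[C]_d) : su Y -> b%:C *: 1%:M + Y = 0 -> b = 0.
  move=> [_ trY] /(congr1 mxtrace); rewrite mxtraceD mxtraceZ mxtrace1 trY addr0 mxtrace0.
  by move/eqP; rewrite mulf_eq0 pnatr_eq0 (gtn_eqF d0) orbF => /eqP[].
have rowE (v : 'rV[R]_(1 + (d ^ 2 - 1))) : v = row_mx (lsubmx v 0 0)%:M (rsubmx v).
  by rewrite -{1}[v]hsubmxK; congr row_mx; apply/rowP => i; rewrite ord1 [in RHS]mxE mulr1n.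
have Bfree : row_free B.
  apply: inj_row_free => v; rewrite {1}(rowE v) BE => /herm_coord_inj v0.
  have sv := su_lin_comb (rsubmx v) sH.
  have {}v0 := v0 (herm_comb _ _ sv.1).
  have b0 := scalar0 _ _ sv v0.
  move: v0; rewrite b0 scale0r add0r => /indep a0.
  by rewrite (rowE v) b0 a0 raddf0 row_mx0.
(* [B] is square: it has 1 + (d^2 - 1) = d * d rows, where 0 < d makes the truncated subtraction
   exact. *)
have Bfull : row_full B.
  move: Bfree; rewrite /row_free /row_full => /eqP ->.
  by rewrite add1n subn1 prednK ?mulnn // expn_gt0 d0.
have /submxP[v Xv] : (herm_coord X <= B)%MS by exact: submx_full.
exists (rsubmx v).
have sv := su_lin_comb (rsubmx v) sH.
have sD := suB sv sX.
(* Equal coordinates of Hermitian matrices give an equality of matrices; the trace then removes the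
   component along the identity. *)
have D0 : (lsubmx v 0 0)%:C *: 1%:M + (lin_comb H (rsubmx v) - X) = 0.
  apply: herm_coord_inj; first exact: herm_comb sD.1.
  by rewrite addrA herm_coordD -BE -rowE -Xv herm_coordN subrr.
move: (D0); rewrite (scalar0 _ _ sD D0) scale0r add0r => /eqP.
by rewrite subr_eq0 => /eqP.
Qed.

End Spanning.

(** * Lower bounds for the minimum gain of a perturbed orthonormal family *)

Section MinGain.
Context {R : realType}.
Local Notation C := R[i].

Definition sup_norm n (a : 'rV[R]_n) : R := \big[Num.max/0]_(j < n) `|a 0 j|.

Lemma le_sup_norm n (a : 'rV[R]_n) j : `|a 0 j| <= sup_norm a.
Proof. exact: (le_bigmax _ (fun j => `|a 0 j|)). Qed.

Lemma sup_norm_ge0 n (a : 'rV[R]_n) : 0 <= sup_norm a.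
Proof. exact: bigmax_ge_id. Qed.

Lemma sup_norm_gt0 n (a : 'rV[R]_n) : a != 0 -> 0 < sup_norm a.
Proof.
apply: contraNT; rewrite -leNgt => a0; apply/eqP/rowP => j; rewrite mxE.
by apply/eqP; rewrite -normr_le0 (le_trans (le_sup_norm a j)).
Qed.

Lemma sup_norm_le_l2 n (a : 'rV[R]_n) : sup_norm a ^+ 2 <= \sum_j a 0 j ^+ 2.
Proof.
rewrite -ler_sqrt ?sum_sqr_ge0 // sqrtr_sqr ger0_norm ?sup_norm_ge0 //.
apply: bigmax_le => [|j _]; first exact: sqrtr_ge0.
rewrite -sqrtr_sqr ler_wsqrtr // (bigD1 j) //= lerDl.
by apply: sumr_ge0 => k _; exact: sqr_ge0.
Qed.

Lemma opnorm_lin_comb_le n d (A : 'I_n -> 'M[C]_d) (a : 'rV[R]_n) (eta : R) :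
  (forall j, opnorm (A j) <= eta) -> opnorm (lin_comb A a) <= n%:R * eta * sup_norm a.
Proof.
move=> Aeta; apply: le_trans (opnorm_sum _) _.
apply: le_trans (_ : \sum_(j < n) sup_norm a * eta <= _); last first.
  by rewrite sumr_const card_ord -[leLHS]mulr_natl mulrA mulrAC.
apply: ler_sum => j _; apply: le_trans (opnormZ _ _) _; rewrite normc_rC.
by apply: ler_pM; [exact: normr_ge0|exact: opnorm_ge0|exact: le_sup_norm|exact: Aeta].
Qed.

Lemma opnorm_ge_frob d (A : 'M[C]_d) : (0 < d)%N -> frob A / Num.sqrt d%:R <= opnorm A.
Proof.
move=> d0; rewrite ler_pdivrMr ?sqrtr_gt0 ?ltr0n // mulrC; exact: frob_opnorm.
Qed.

(** The exact combination has Frobenius norm h |a|_2 >= h |a|_oo, hence operator norm at least h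
    |a|_oo / sqrt(d); the [n] errors subtract at most n eta |a|_oo. *)
Lemma opnorm_perturbed_comb_ge n d (L H : 'I_n -> 'M[C]_d) (h eta : R) (a : 'rV[R]_n) :
  (0 < d)%N -> 0 <= h ->
  (forall i j, frob_dot (L i) (L j) = (i == j)%:R) ->
  (forall j, opnorm (H j - h%:C *: L j) <= eta) ->
  (h / Num.sqrt d%:R - n%:R * eta) * sup_norm a <= opnorm (lin_comb H a).
Proof.
move=> d0 h0 orth close.
have frobL : sup_norm a <= frob (lin_comb L a).
  rewrite -(ler_pXn2r (ltn0Sn 1)) ?nnegrE ?sup_norm_ge0 ?frob_ge0 //.
  by rewrite (sqr_frob_comb _ orth) sup_norm_le_l2.
have LE : h%:C *: lin_comb L a = lin_comb H a - lin_comb (fun j => H j - h%:C *: L j) a.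
  rewrite /lin_comb scaler_sumr -sumrB; apply: eq_bigr => j _.
  by rewrite scalerBr opprB addrC subrK !scalerA mulrC.
have : h * sup_norm a / Num.sqrt d%:R <= opnorm (h%:C *: lin_comb L a).
  apply: le_trans (opnorm_ge_frob _ d0); rewrite frobZ normc_rC ger0_norm //.
  by rewrite ler_wpM2r ?invr_ge0 ?sqrtr_ge0 // ler_wpM2l.
rewrite LE => lb.
have -> : (h / Num.sqrt d%:R - n%:R * eta) * sup_norm a =
  h * sup_norm a / Num.sqrt d%:R - n%:R * eta * sup_norm a by ring.
rewrite lerBlDr; apply: (le_trans lb); apply: le_trans (opnormD _ _) _.
by rewrite lerD2l opnormN; exact: opnorm_lin_comb_le.
Qed.

Lemma min_gain_ge n d (H : 'I_n -> 'M[C]_d) (g : R) : (0 < n)%N ->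
  (forall a : 'rV[R]_n, g * sup_norm a <= opnorm (lin_comb H a)) -> g <= min_gain H.
Proof.
move=> n0 gH; apply: lb_le_inf.
  (* The infimum must range over a nonempty set; the all-ones vector is nonzero because 0 < n. *)
  pose u : 'rV[R]_n := const_mx 1; exists (opnorm (lin_comb H u) / sup_norm u), u => //=.
  apply/eqP => /rowP/(_ (Ordinal n0)) /eqP; by rewrite !mxE oner_eq0.
move=> _ [a /= a0 <-]; rewrite ler_pdivlMr; first exact: gH.
exact: sup_norm_gt0.
Qed.

End MinGain.

(** * Half-integer powers of the dimension *)

Section Numerics.
Context {R : realType}.

Lemma powR_five_halves d : d%:R `^ (5 / 2) = d%:R ^+ 2 * Num.sqrt d%:R :> R.
Proof.
have -> : 5 / 2 = 2%:R + 2^-1 :> R by field.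
by rewrite powRD ?powR_mulrn ?powR12_sqrt //; apply/implyP => /eqP; lra.
Qed.

Lemma powR_opp_nineteen_halves d : (0 < d)%N ->
  d%:R `^ (- (19 / 2)) = (d%:R ^+ 9 * Num.sqrt d%:R)^-1 :> R.
Proof.
move=> d0; have -> : 19 / 2 = 9%:R + 2^-1 :> R by field.
rewrite powRN powRD ?powR_mulrn ?powR12_sqrt //.
by apply/implyP => /eqP; lra.
Qed.

End Numerics.

(** * Scalar inequalities, used with D = d, q = sqrt(d), m = d^2 - 1 and p = pi *)

Section Constants.
Context {R : realType}.
Implicit Types (C e K hs D q m p h nu : R).

Lemma c_const_ge1 C : 1 <= C -> 1 <= c_const C.
Proof.
move=> C1; rewrite /c_const.
have := pi_ge2 R; have := sqrtr_ge0 (2 * pi : R).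
have : 0 <= (32 * pi) `^ (3 / 2) * C by rewrite mulr_ge0 ?powR_ge0 //; lra.
lra.
Qed.

Lemma eps_lt1 C e b : 1 <= C -> e < Num.min (1 / c_const C ^+ 2) b -> e < 1.
Proof.
move=> /c_const_ge1 c1; rewrite lt_min => /andP[eC _]; apply: lt_le_trans eC _.
by rewrite div1r invf_le1 ?exprn_gt0 ?exprn_ege1 // (lt_le_trans ltr01).
Qed.

(** From D >= 2, m >= D^2/2, so m^3 >= D^6/8. The first bound makes the eigenangles small enough for
    the logarithm; the second yields the order d^(-19/2) of the tolerance. *)
Lemma denominator_ge D p m K : 2 <= D -> 2 <= p -> m = D ^+ 2 - 1 -> 32 <= K ->
  24 * D <= 16 * D * p ^+ 2 * m ^+ 3 * K /\ D ^+ 7 <= 16 * D * p ^+ 2 * m ^+ 3 * K.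
Proof.
move=> D2 p2 mE K32.
have D2m : D ^+ 2 / 2 <= m by rewrite mE; nra.
have m1 : 1 <= m by rewrite mE; nra.
have D0 : 0 <= D by lra.
have p4 : 4 <= p ^+ 2 by nra.
have m31 : 1 <= m ^+ 3 by exact: exprn_ege1.
have m3D : D ^+ 6 / 8 <= m ^+ 3.
  apply: le_trans (_ : (D ^+ 2 / 2) ^+ 3 <= _).
    by rewrite expr_div_n -exprM -natrX.
  by rewrite ler_pXn2r ?nnegrE ?divr_ge0 ?exprn_ge0 //; lra.
have D60 : 0 <= D ^+ 6 by exact: exprn_ge0.
have lb x : 0 <= x -> x <= m ^+ 3 -> 16 * D * 4 * x * 32 <= 16 * D * p ^+ 2 * m ^+ 3 * K.
  move=> x0 xm; apply: ler_pM => //; first by rewrite !mulr_ge0.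
  apply: ler_pM => //; first by rewrite !mulr_ge0.
  by apply: ler_wpM2l => //; rewrite mulr_ge0.
split.
  by apply: le_trans (lb 1 _ _) => //; lra.
apply: le_trans (lb _ _ m3D); last by rewrite divr_ge0.
rewrite exprS; have : 0 <= D * D ^+ 6 by rewrite mulr_ge0.
have -> : 16 * D * 4 * (D ^+ 6 / 8) * 32 = 256 * (D * D ^+ 6) by field.
lra.
Qed.

(** Since hs = 2 D^2 q eta, one has 2q (hs/q - m eta) = hs + 2 q eta. The surplus 2 q eta, due to
    the -1 in [m], covers the excess eta allowed in h <= hs + eta. *)
Lemma gain_ratio q D hs eta m g h : 1 <= q -> q ^+ 2 = D -> 0 < hs -> m = D ^+ 2 - 1 ->
  eta = hs / (2 * (D ^+ 2 * q)) -> hs / q - m * eta <= g -> 0 < h ->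
  h <= hs * (1 + 1 / (2 * (D ^+ 2 * q))) -> 1 / (2 * q) <= g / h.
Proof.
move=> q1 qD hs0 mE etaE gl h0 hl.
have q0 : 0 < q by lra.
have D1 : 1 <= D by rewrite -qD; nra.
have D0 : 0 < D by lra.
have D20 : 0 < D ^+ 2 by exact: exprn_gt0.
rewrite ler_pdivlMr // mul1r ler_pdivrMl ?mulr_gt0 //.
apply: le_trans hl _; apply: le_trans (_ : 2 * q * (hs / q - m * eta) <= _); last first.
  by rewrite ler_pM2l // mulr_gt0.
have eta0 : 0 < eta.
  by rewrite etaE; apply: divr_gt0 => //; do 2?apply: mulr_gt0.
have hsE : hs = 2 * (D ^+ 2 * q) * eta.
  by rewrite etaE; field; rewrite !gt_eqF.
have -> : hs * (1 + 1 / (2 * (D ^+ 2 * q))) = hs + eta.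
  by rewrite etaE; field; rewrite !gt_eqF.
have -> : 2 * q * (hs / q - m * eta) = 2 * hs - 2 * q * m * eta by field; rewrite gt_eqF.
rewrite mE hsE; have : 1 * eta <= q * eta by rewrite ler_pM2r.
have -> : 2 * (2 * (D ^+ 2 * q) * eta) - 2 * q * (D ^+ 2 - 1) * eta
  = 2 * (D ^+ 2 * q) * eta + 2 * (q * eta) by ring.
lra.
Qed.

(** Each of the two terms of the denominator, multiplied by [h], is at most half of e^2 nu^2: the
    first because nu^2 >= 1/(4D), the second because p^2 m^3 K >= 128 m forces h m <= e/2. *)
Lemma goodness q D e p m K nu h : 1 <= q -> q ^+ 2 = D -> 0 < e < 1 -> 2 <= p -> 1 <= m ->
  32 <= K -> 0 <= h -> h <= e ^+ 2 / (8 * p ^+ 2 * D * m ^+ 3 * K) -> 1 / (2 * q) <= nu ->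
  h <= e ^+ 2 * nu ^+ 2 / (p ^+ 2 * m ^+ 3 * K + e * nu ^+ 2 * m).
Proof.
move=> q1 qD /andP[e0 e1] p2 m1 K32 h0 hl nul.
have q0 : 0 < q by lra.
have D1 : 1 <= D by rewrite -qD; nra.
have nu2 : 1 / (4 * D) <= nu ^+ 2.
  have -> : 1 / (4 * D) = (1 / (2 * q)) ^+ 2.
    by rewrite -qD; field; rewrite gt_eqF.
  by rewrite ler_pXn2r ?nnegrE ?divr_ge0 ?(le_trans _ nul) ?divr_ge0 //; lra.
have nu20 : 0 < nu ^+ 2 by apply: lt_le_trans nu2; rewrite divr_gt0 //; lra.
have p4 : 4 <= p ^+ 2 by nra.
have m0 : 0 < m by lra.
have pD : 0 < p ^+ 2 by lra.
have m30 : 0 < m ^+ 3 by exact: exprn_gt0.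
have T0 : 0 < p ^+ 2 * m ^+ 3 * K by do 2?apply: mulr_gt0 => //; lra.
have enm0 : 0 < e * nu ^+ 2 * m by do 2?apply: mulr_gt0.
rewrite ler_pdivlMr; last exact: addr_gt0.
have hT : h * (p ^+ 2 * m ^+ 3 * K) <= e ^+ 2 / (8 * D).
  move: hl; rewrite ler_pdivlMr; last by do 4?apply: mulr_gt0 => //; lra.
  rewrite ler_pdivlMr ?mulr_gt0 //; last lra.
  by apply: le_trans; rewrite le_eqVlt; apply/orP; left; apply/eqP; ring.
have step1 : h * (p ^+ 2 * m ^+ 3 * K) <= e ^+ 2 * nu ^+ 2 / 2.
  apply: le_trans hT _.
  have -> : e ^+ 2 / (8 * D) = e ^+ 2 * (1 / (4 * D)) / 2 by field; rewrite gt_eqF //; lra.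
  by rewrite ler_pM2r // ler_pM2l // exprn_gt0.
have hm : h * m <= e / 2.
  have m2 : m <= m ^+ 3 by rewrite exprS ler_peMr ?exprn_ege1 // ltW.
  have mT : m * 4 * 32 <= p ^+ 2 * m ^+ 3 * K.
    apply: ler_pM => //; first by rewrite mulr_ge0 //; lra.
    by rewrite [leRHS]mulrC; apply: ler_pM => //; lra.
  have : h * (m * 4 * 32) <= e ^+ 2 / (8 * D) by apply: le_trans hT; rewrite ler_wpM2l.
  have : e ^+ 2 / (8 * D) <= e.
    rewrite ler_pdivrMr ?mulr_gt0 //; last lra.
    by rewrite expr2 ler_pM2l //; lra.
  have : 0 <= h * m by rewrite mulr_ge0 // ltW.
  have -> : h * (m * 4 * 32) = 128 * (h * m) by ring.
  lra.
have step2 : h * (e * nu ^+ 2 * m) <= e ^+ 2 * nu ^+ 2 / 2.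
  have -> : h * (e * nu ^+ 2 * m) = e * nu ^+ 2 * (h * m) by ring.
  have -> : e ^+ 2 * nu ^+ 2 / 2 = e * nu ^+ 2 * (e / 2) by field.
  by rewrite ler_pM2l // mulr_gt0.
lra.
Qed.

(** The factor pi in the tolerance absorbs the Lipschitz constant 2 of the logarithm. The second
    bound is the condition on sqrt(d) delta in [is_log_perturbation]. *)
Lemma log_error_le p q D hs : 2 <= p -> 1 <= q -> q ^+ 2 = D -> 0 < hs ->
  2 * (hs / (2 * p * (D ^+ 2 * q))) <= hs / (2 * (D ^+ 2 * q)) /\
  q * (hs / (2 * p * (D ^+ 2 * q))) <= hs.
Proof.
move=> p2 q1 qD hs0.
have D1 : 1 <= D by rewrite -qD; nra.
have [D0 [p0 q0]] : 0 < D /\ 0 < p /\ 0 < q by lra.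
split.
  have -> : 2 * (hs / (2 * p * (D ^+ 2 * q))) = hs / (2 * (D ^+ 2 * q)) * (2 / p).
    by field; rewrite !gt_eqF.
  have D20 : 0 < D ^+ 2 * q by rewrite mulr_gt0 // exprn_gt0.
  apply: ler_piMr; last by rewrite ler_pdivrMr // mul1r.
  by apply: divr_ge0; [exact: ltW|lra].
have -> : q * (hs / (2 * p * (D ^+ 2 * q))) = hs * (2 * p * D ^+ 2)^-1.
  by field; rewrite !gt_eqF.
have D20 : 1 <= D ^+ 2 by exact: exprn_ege1.
apply: ler_piMr; first exact: ltW.
by rewrite invf_le1; nra.
Qed.

Lemma step_size_double p q D m K e hs T : 0 < p -> 1 <= q -> 1 <= D -> 1 <= m -> 32 <= K ->
  T = 16 * D * p ^+ 2 * m ^+ 3 * K -> 0 < hs -> hs <= e ^+ 2 / T ->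
  hs * (1 + 1 / (2 * (D ^+ 2 * q))) <= e ^+ 2 / (8 * p ^+ 2 * D * m ^+ 3 * K).
Proof.
move=> p0 q1 D1 m1 K32 TE hs0 hsu.
have [D0 [m0 [q0 K0]]] : 0 < D /\ 0 < m /\ 0 < q /\ 0 < K by lra.
have -> : e ^+ 2 / (8 * p ^+ 2 * D * m ^+ 3 * K) = 2 * (e ^+ 2 / T).
  by rewrite TE; field; rewrite !gt_eqF.
apply: le_trans (_ : 2 * hs <= _); last by rewrite ler_pM2l.
rewrite mulrC ler_pM2r //.
have D2 : 1 <= D ^+ 2 by exact: exprn_ege1.
have : 1 / (2 * (D ^+ 2 * q)) <= 1; last by lra.
rewrite div1r invf_le1 ?mulr_gt0 //; first by nra.
Qed.

(** As m <= D^2, the accumulated errors consume at most half of hs / q. *)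
Lemma gain_gt0 q D hs m : 1 <= q -> q ^+ 2 = D -> 0 < hs -> 0 <= m -> m <= D ^+ 2 ->
  0 < hs / q - m * (hs / (2 * (D ^+ 2 * q))).
Proof.
move=> q1 qD hs0 m0 mD.
have D1 : 1 <= D by rewrite -qD; nra.
have [D0 q0] : 0 < D /\ 0 < q by lra.
have D20 : 0 < D ^+ 2 by exact: exprn_gt0.
have -> : hs / q - m * (hs / (2 * (D ^+ 2 * q))) = hs / q * (1 - m / (2 * D ^+ 2)).
  by field; rewrite !gt_eqF.
rewrite mulr_gt0 ?divr_gt0 // subr_gt0 ltr_pdivrMr ?mulr_gt0 //; lra.
Qed.

(** The exponents add up as 7 + 5/2 = 19/2. *)
Lemma tolerance_order p q D hs : 2 <= p -> 1 <= q -> 1 <= D -> 0 < hs -> hs * D ^+ 7 <= 1 ->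
  hs / (2 * p * (D ^+ 2 * q)) <= 1 / (D ^+ 9 * q).
Proof.
move=> p2 q1 D1 hs0 hsD.
have [D0 [p0 q0]] : 0 < D /\ 0 < p /\ 0 < q by lra.
have -> : hs / (2 * p * (D ^+ 2 * q)) = 1 / (D ^+ 9 * q) * (hs * D ^+ 7 / (2 * p)).
  by field; rewrite !gt_eqF.
rewrite ler_piMr //; first by rewrite divr_ge0 // mulr_ge0 ?exprn_ge0 // ltW.
rewrite ler_pdivrMr ?mulr_gt0 //; lra.
Qed.

End Constants.

(** * Assembly: stability of the Gell-Mann exponential basis *)

Lemma hermZ_real (R : realType) d (h : R) (A : 'M[R[i]]_d) :
  A \is hermsymmx -> h%:C *: A \is hermsymmx.
Proof.
move=> Ah; apply/is_hermitianmxP; rewrite expr0 scale1r; apply/matrixP => i j.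
by rewrite !mxE rmorphM /= -herm_entry // conj_rC.
Qed.

Theorem theorem4p22 (R : realType) (delta0 C eps0 K : R)
    (hdelta0 : 0 < delta0 < pi) (hC : 1 <= C) (hBCH : bch_constants delta0 C)
    (heps0 : 0 < eps0 < Num.min (1 / c_const C ^+ 2) (delta0 ^+ 2 / (32 * pi)))
    (hK : 32 * Num.sqrt C <= K) :
  exists A : R, 0 < A /\
  forall d : nat, (2 <= d)%N -> let M := (d ^ 2 - 1)%N in
  forall hs : R,
    0 < hs -> hs <= eps0 ^+ 2 / (16 * d%:R * pi ^+ 2 * M%:R ^+ 3 * K) ->
  forall G H : 'I_M -> 'M[R[i]]_d,
    let Hs := fun j => hs%:C *: gell_mann j in
    let Gs := fun j => expmx ('i%C *: Hs j) in
    (forall j, SU (G j)) ->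
    (forall j, is_log (G j) (H j)) ->
    max_norm (fun j => Gs j - G j) <= hs / (2 * pi * d%:R `^ (5 / 2)) ->
  [/\ hs / (2 * pi * d%:R `^ (5 / 2)) <= A * d%:R `^ (- (19 / 2)),
      max_norm H <= hs * (1 + 1 / (2 * d%:R `^ (5 / 2))),
      hs * (1 + 1 / (2 * d%:R `^ (5 / 2)))
        <= eps0 ^+ 2 / (8 * pi ^+ 2 * d%:R * M%:R ^+ 3 * K),
      1 / (2 * Num.sqrt d%:R) <= norm_min_gain H &
      good_exp_basis eps0 K G H].
Proof.
clear hBCH hdelta0.
have e0 : 0 < eps0 by case/andP: heps0.
have e1 : eps0 < 1 by case/andP: heps0 => _; exact: eps_lt1.
have K32 : 32 <= K.
  apply: le_trans hK; rewrite ler_peMr // -sqrtr1 ler_wsqrtr //.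
have pi2 := pi_ge2 R; have pi0 := pi_gt0 R.
(* The implied constant of the O-term is 1, chosen before [d] and hence uniform in the dimension. *)
exists 1; split=> // d d2 M hs hs0 hsu G H Hs Gs sG logG dist.
have d0 : (0 < d)%N by exact: ltnW.
set D : R := d%:R in hsu *; set q := Num.sqrt D.
have D2 : 2 <= D by rewrite ler_nat.
have D0 : 0 < D by lra.
have qD : q ^+ 2 = D by rewrite sqr_sqrtr // ltW.
have q1 : 1 <= q by rewrite -sqrtr1 ler_wsqrtr //; lra.
have q0 : 0 < q by lra.
have PE : D `^ (5 / 2) = D ^+ 2 * q by exact: powR_five_halves.
rewrite powR_opp_nineteen_halves // -/D -/q PE in dist *.
have mE : (M%:R : R) = D ^+ 2 - 1.
  by rewrite /M natrB ?expn_gt0 ?d0 // natrX.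
set m : R := M%:R in hsu mE *.
(* The defining equations are kept so that the three scalars can become opaque to arithmetic and
   still be unfolded later. *)
have DE : D = d%:R by []; have qE : q = Num.sqrt d%:R by []; have mM : m = M%:R by [].
clearbody D q m.
have m1 : 1 <= m by rewrite mE; nra.
have M0 : (0 < M)%N by rewrite -(ltr_nat R) -mM; lra.
have D1 : 1 <= D by lra.
have D20 : 0 < D ^+ 2 by exact: exprn_gt0.
have Dq0 : 0 < D ^+ 2 * q by exact: mulr_gt0.
have [T24 T7] := denominator_ge D2 pi2 mE K32.
set T := 16 * D * pi ^+ 2 * m ^+ 3 * K in hsu T24 T7.
have T0 : 0 < T by lra.
have ee : eps0 ^+ 2 <= 1 by rewrite exprn_ile1 // ltW.
have hsT : hs * T <= 1 by apply: le_trans ee; rewrite -ler_pdivlMr.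
have small : 24 * D * hs <= 1.
  by apply: le_trans hsT; rewrite mulrC ler_pM2l.
have hsD7 : hs * D ^+ 7 <= 1 by apply: le_trans hsT; rewrite ler_pM2l.
set delta := hs / (2 * pi * (D ^+ 2 * q)) in dist *.
(* The error allowed for each logarithm, equal to the increment of the claimed bound on [max_norm H]
   over [hs]. *)
pose eta := hs / (2 * (D ^+ 2 * q)).
have [deltaeta qdelta] := log_error_le pi2 q1 qD hs0.
rewrite -/delta -/eta in deltaeta qdelta.
have key j : [/\ su (H j), expmx ('i%C *: H j) = G j & opnorm (H j - Hs j) <= eta].
  have hsn : normc (hs%:C : R[i]) = hs by rewrite normc_rC ger0_norm // ltW.
  have Hsh : Hs j \is hermsymmx.
    exact: hermZ_real (gell_mann_herm j).
  have Hsf : frob (Hs j) <= hs by rewrite frobZ hsn gell_mann_frob mulr1.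
  have close : opnorm (expmx ('i%C *: Hs j) - G j) <= delta.
    by apply: le_trans dist; exact: (le_bigmax _ (fun j => opnorm (Gs j - G j))).
  rewrite DE in small; rewrite qE in qdelta.
  have [sH exH dH] := is_log_perturbation d0 (logG j) Hsh Hsf small close qdelta.
  by split=> //; exact: le_trans dH deltaeta.
have maxH : max_norm H <= hs * (1 + 1 / (2 * (D ^+ 2 * q))).
  have hE : hs * (1 + 1 / (2 * (D ^+ 2 * q))) = hs + eta.
    by rewrite /eta; field; rewrite !gt_eqF.
  have eta0 : 0 <= eta by rewrite /eta divr_ge0 ?mulr_ge0 // ltW.
  rewrite hE; apply: bigmax_le => [|j _]; first by lra.
  have [_ _ dj] := key j.
  have -> : H j = Hs j + (H j - Hs j) by rewrite addrC subrK.
  apply: le_trans (opnormD _ _) _; apply: (lerD _ dj); apply: le_trans (opnorm_frob _) _.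
  by rewrite frobZ normc_rC gtr0_norm // gell_mann_frob mulr1.
have hs2u := step_size_double pi0 q1 D1 m1 K32 (erefl T) hs0 hsu.
have gain a : (hs / q - m * eta) * sup_norm a <= opnorm (lin_comb H a).
  rewrite qE mM; apply: (opnorm_perturbed_comb_ge a d0 (ltW hs0) (@gell_mann_orth R d)) => j.
  by case: (key j).
have gain0 : 0 < hs / q - m * eta.
  by apply: (gain_gt0 q1 qD hs0); [exact: le_trans ler01 m1|rewrite mE gerBl].
have indep (a : 'rV[R]_M) : lin_comb H a = 0 -> a = 0.
  move=> a0; apply/eqP; apply: contraT => /sup_norm_gt0 an.
  have := gain a; rewrite a0 leNgt (le_lt_trans _ (mulr_gt0 gain0 an)) //.
  by apply: le_trans (opnorm_frob _) _; rewrite frob0.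
(* Positivity is needed to divide by [max_norm H]. If it were zero, every combination would have
   norm 0, against the gain at the all-ones vector. *)
have h0 : 0 < max_norm H.
  rewrite lt_def; apply/andP; split; last exact: bigmax_ge_id.
  apply/eqP => mH.
  have H0 j : opnorm (H j) <= 0.
    by rewrite -mH; exact: (le_bigmax _ (fun j => opnorm (H j))).
  have one : (const_mx 1 : 'rV[R]_M) != 0.
    by apply/eqP => /rowP/(_ (Ordinal M0))/eqP; rewrite !mxE oner_eq0.
  have := le_trans (gain _) (opnorm_lin_comb_le (const_mx 1) H0).
  by rewrite mulr0 mul0r leNgt (mulr_gt0 gain0 (sup_norm_gt0 one)).
have ratio : 1 / (2 * q) <= norm_min_gain H.
  exact: (gain_ratio q1 qD hs0 mE (erefl eta) (min_gain_ge M0 gain) h0 maxH).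
split=> //.
- by rewrite mul1r -div1r; exact: tolerance_order.
- split; first split.
  + by move=> j; case: (key j).
  + split=> [j||X sX]; first by case: (key j).
      exact: indep.
    by apply: su_span_of_independent => // j; case: (key j).
  + rewrite -mM; apply: (goodness (q := q) (D := D)) => //; first by rewrite e0.
      exact: ltW.
    exact: le_trans maxH hs2u.
Qed.
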